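(* When the number $K\ge 1$ of terminals is fixed, ML-CAP-STEINER-TREE can be reduced in polynomial time to ML-LAB-VDISJ-PATH with a fixed number of source-sink pairs. (This holds for undirected graphs, and likewise for directed graphs.)
   Context: Graphs $G=(V,E)$ are finite and may be directed or undirected; ''path'' means directed path in the directed case. ML-CAP-STEINER-TREE. Input: a connected graph $G=(V,E)$; a set $T\subset V$ of $K\ge 1$ terminals; a root $r\in V\setminus T$ (if $G$ is directed, there is a directed path from $r$ to every vertex of $V$); a nonnegative rational length $\ell(e)$ and a positive integer capacity $c(e)$ for every $e\in E$. Objective: determine, if one exists, a tree $S$ in $G$, directed away from its root $r$, that spans all vertices of $T$ (it need not span $V$), satisfies the capacity constraints, and has minimum total length. The capacity constraints say: for every arc $e=(u,v)$ of $S$, the subtree of $S$ rooted at $v$ contains at most $c(e)$ terminals. If $G$ is undirected, an arc $(u,v)$ of $S$ must be such that $[u,v]\in E$, and it has the length and capacity of that edge. ML-LAB-VDISJ-PATH. Input: a graph $G=(V,E)$; an integer $k\ge 1$; a nonnegative length function $\ell$ on $E$; a label $\lambda(e)\in\{1,\dots,k\}$ for every $e\in E$; $p$ disjoint vertex pairs (source-sink pairs) $(s_i,s'_i)$, each associated with a set $L_i\subseteq\{1,\dots,k\}$ of labels. Objective: find, if they exist, $p$ mutually vertex-disjoint paths $\mu_1,\dots,\mu_p$ of minimum total length such that $\mu_i$ links $s_i$ to $s'_i$ and all labels on $\mu_i$ belong to $L_i$ ($i=1,\dots,p$). ''Fixed number of source-sink pairs'' means a number of pairs bounded by a constant depending only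 on $K$. ''Reduced in polynomial time'' means: an instance of the first problem can be solved in polynomial time given an oracle that solves instances of the second problem (so polynomially many instances of the second problem, on graphs of the same type, may be solved). *)

(* Defs.v *)
From HB Require Import structures.
From mathcomp Require Import all_boot all_order all_algebra.

Set Implicit Arguments.
Unset Strict Implicit.
Unset Printing Implicit Defensive.

Import Order.TTheory GRing.Theory Num.Theory.

(** * Oracle computation with a cost measure

    Programs manipulate finite binary trees whose leaves are natural numbers
    written in binary.  Every elementary operation, including a query, is
    charged the size of its argument plus the size of its result, so that a
    run of cost [t] only handles data of size at most [t] (lemma [eval_size]);
    since all elementary operations are computable in polynomial time on a
    Turing machine, polynomial cost here coincides with polynomial time on a
    deterministic oracle Turing machine that reads and writes its queries and
    answers symbol by symbol. *)

Inductive data : Type :=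
| Num of nat
| Pair of data & data.

(* [(trunc_log 2 n).+1] is the number of binary digits of [n] (1 for [n = 0]) *)
Fixpoint dsize (x : data) : nat :=
  match x with
  | Num n => (trunc_log 2 n).+1
  | Pair y z => (dsize y + dsize z).+1
  end.

Definition dtrue (x : data) : bool := if x is Num 0 then false else true.

Inductive prim : Type :=
| Id | Const of data | Fst | Snd | IsPair | Add | Sub | Mul | Leq.

(* Ill-typed arguments yield [Num 0]; [Sub] is truncated subtraction. *)
Definition prim_sem (a : prim) (x : data) : data :=
  match a, x with
  | Id, _ => x
  | Const d, _ => d
  | Fst, Pair y _ => y
  | Snd, Pair _ z => z
  | IsPair, Pair _ _ => Num 1
  | Add, Pair (Num m) (Num n) => Num (m + n)
  | Sub, Pair (Num m) (Num n) => Num (m - n)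
  | Mul, Pair (Num m) (Num n) => Num (m * n)
  | Leq, Pair (Num m) (Num n) => Num (m <= n)
  | _, _ => Num 0
  end.

Inductive prog : Type :=
| Prim of prim
| Query
| Seq of prog & prog
| Fork of prog & prog
| If of prog & prog & prog
| While of prog & prog.

(* [eval O p x y t]: with oracle [O], program [p] halts on input [x] with
   output [y] at cost [t].  The oracle is a partial function; a query outside
   its domain blocks the computation. *)
Inductive eval (O : data -> option data) : prog -> data -> data -> nat -> Prop :=
| EvalPrim a x :
    eval O (Prim a) x (prim_sem a x) (dsize x + dsize (prim_sem a x))
| EvalQuery x y :
    O x = Some y -> eval O Query x y (dsize x + dsize y)
| EvalSeq p q x y z t u :
    eval O p x y t -> eval O q y z u -> eval O (Seq p q) x z (t + u)
| EvalFork p q x y z t u :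
    eval O p x y t -> eval O q x z u ->
    eval O (Fork p q) x (Pair y z) (t + u).+1
| EvalIfTrue b p q x c y t u :
    eval O b x c t -> dtrue c -> eval O p x y u ->
    eval O (If b p q) x y (t + u).+1
| EvalIfFalse b p q x c y t u :
    eval O b x c t -> ~~ dtrue c -> eval O q x y u ->
    eval O (If b p q) x y (t + u).+1
| EvalWhileDone b p x c t :
    eval O b x c t -> ~~ dtrue c -> eval O (While b p) x x t.+1
| EvalWhileStep b p x c y z t u v :
    eval O b x c t -> dtrue c -> eval O p x y u ->
    eval O (While b p) y z v ->
    eval O (While b p) x z (t + u + v).+1.

Lemma eval_size (O : data -> option data) p x y t :
  eval O p x y t -> dsize x <= t /\ dsize y <= t.
Proof.
elim=> {p x y t}.
- by move=> a x; rewrite leq_addr leq_addl.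
- by move=> x y _; rewrite leq_addr leq_addl.
- move=> p q x y z t u _ [xt _] _ [_ zu]; split.
    exact: leq_trans xt (leq_addr _ _).
  exact: leq_trans zu (leq_addl _ _).
- move=> p q x y z t u _ [xt yt] _ [_ zu] /=; split.
    exact: leqW (leq_trans xt (leq_addr _ _)).
  by rewrite ltnS leq_add.
- move=> b p q x c y t u _ [xt _] _ _ [_ yu]; split.
    exact: leqW (leq_trans xt (leq_addr _ _)).
  exact: leqW (leq_trans yu (leq_addl _ _)).
- move=> b p q x c y t u _ [xt _] _ _ [_ yu]; split.
    exact: leqW (leq_trans xt (leq_addr _ _)).
  exact: leqW (leq_trans yu (leq_addl _ _)).
- by move=> b p x c t _ [xt _] _; rewrite leqW.
- move=> b p x c y z t u v _ [xt _] _ _ _ _ [_ zv]; split.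
    by apply: leqW; rewrite -addnA (leq_trans xt) ?leq_addr.
  exact: leqW (leq_trans zv (leq_addl _ _)).
Qed.

Lemma eval_det (O : data -> option data) p x y t y' t' :
  eval O p x y t -> eval O p x y' t' -> y = y' /\ t = t'.
Proof.
move=> e; elim: e y' t' => {p x y t};
  intros; match goal with H : eval _ _ _ _ ?t |- _ = _ /\ _ = ?t => inversion H end;
  subst;
  repeat match goal with
  | IH : forall y t, eval _ ?p ?x y t -> _, H : eval _ ?p ?x _ _ |- _ =>
      case: (IH _ _ H) => ? ?; subst; clear H
  end; try by [split; congruence];
  match goal with H : is_true (~~ dtrue ?c) |- _ => by case/negP: H end.
Qed.

(** * Problems and polynomial-time (Turing) reductions *)

(* [answers i y]: the data [y] encodes a correct answer to the instance [i]. *)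
Record problem : Type := Problem {
  instance : Type;
  valid : instance -> Prop;
  encode : instance -> data;
  answers : instance -> data -> Prop
}.

(* Nothing is assumed about [O] outside the encodings of valid instances. *)
Definition solves (O : data -> option data) (B : problem) : Prop :=
  forall j : instance B, valid j -> exists2 y, O (encode j) = Some y & answers j y.

Definition poly_time_reducible (A B : problem) : Prop :=
  exists (p : prog) (a d : nat),
    forall O : data -> option data, solves O B ->
    forall i : instance A, valid i ->
    exists (y : data) (t : nat),
      [/\ eval O p (encode i) y t,
          t <= a * dsize (encode i) ^ d &
          answers i y].

(** * Encodings *)

Definition enc_list (A : Type) (f : A -> data) (s : seq A) : data :=
  foldr (fun x d => Pair (f x) d) (Num 0) s.

Definition enc_option (A : Type) (f : A -> data) (x : option A) : data :=
  if x is Some a then Pair (f a) (Num 0) else Num 0.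

Definition enc_ord (n : nat) (i : 'I_n) : data := Num i.

(* Only used for nonnegative rationals. *)
Definition enc_rat (x : rat) : data :=
  Pair (Num (absz (numq x))) (Num (absz (denq x))).

Definition enc_set (n : nat) (L : {set 'I_n}) : data :=
  enc_list (@enc_ord n) (enum L).

(** * Graphs

    A simple graph on the vertices [0, ..., n-1] whose edges carry a length
    and an attribute of type [A] (a capacity or a label) is the matrix whose
    [(u, v)] entry is [Some (length, attribute)] if there is an arc from [u]
    to [v] and [None] otherwise.  An undirected graph is a symmetric one. *)

Section Graphs.
Variables (A : Type) (n : nat).
Implicit Type G : 'M[option (rat * A)]_n.

Definition adj G : rel 'I_n := fun u v => isSome (G u v).

Definition len G (a : 'I_n * 'I_n) : rat :=
  if G a.1 a.2 is Some e then e.1 else 0%R.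

Definition simple_graph (directed : bool) G : Prop :=
  (forall u, ~~ adj G u u) /\
  (~~ directed -> forall u v, G u v = G v u).

Definition connected G : Prop :=
  forall u v, connect [rel x y | adj G x y || adj G y x] u v.

Definition nonneg_lengths G : Prop := forall a, (0 <= len G a)%R.

Definition enc_graph (f : A -> data) G : data :=
  enc_list
    (fun u => enc_list
       (fun v => enc_option (fun e => Pair (enc_rat e.1) (f e.2)) (G u v))
       (enum 'I_n))
    (enum 'I_n).

End Graphs.

(** * ML-CAP-STEINER-TREE *)

Record steiner_instance : Type := SteinerInstance {
  st_n : nat;
  st_graph : 'M[option (rat * nat)]_st_n;
  st_terminals : {set 'I_st_n};
  st_root : 'I_st_n
}.

Definition capacity n (G : 'M[option (rat * nat)]_n) (a : 'I_n * 'I_n) : nat :=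
  if G a.1 a.2 is Some e then e.2 else 0.

Definition steiner_valid (directed : bool) (K : nat) (I : steiner_instance) :
    Prop :=
  let G := st_graph I in
  let r := st_root I in
  [/\ simple_graph directed G,
      connected G,
      (directed -> forall v, connect (adj G) r v),
      #|st_terminals I| = K /\ r \notin st_terminals I &
      nonneg_lengths G /\
      (forall u v, adj G u v -> 0 < capacity G (u, v))].

Definition enc_steiner (I : steiner_instance) : data :=
  Pair (Num (st_n I))
    (Pair (enc_graph Num (st_graph I))
       (Pair (enc_set (st_terminals I)) (enc_ord (st_root I)))).

(* A tree is given by its set of arcs; the set of its vertices consists of the
   root and of the endpoints of the arcs. *)
Definition arc_rel n (S : {set 'I_n * 'I_n}) : rel 'I_n :=
  fun u v => (u, v) \in S.

Definition tree_vertices n (S : {set 'I_n * 'I_n}) (r : 'I_n) : {set 'I_n} :=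
  r |: ([set a.1 | a in S] :|: [set a.2 | a in S]).

Definition out_tree n (S : {set 'I_n * 'I_n}) (r : 'I_n) : Prop :=
  [/\ forall u, (u, r) \notin S,
      forall u u' v, (u, v) \in S -> (u', v) \in S -> u = u' &
      forall v, v \in tree_vertices S r -> connect (arc_rel S) r v].

Definition steiner_feasible (I : steiner_instance)
    (S : {set 'I_(st_n I) * 'I_(st_n I)}) : Prop :=
  [/\ forall u v, (u, v) \in S -> adj (st_graph I) u v,
      out_tree S (st_root I),
      st_terminals I \subset tree_vertices S (st_root I) &
      forall u v, (u, v) \in S ->
        #|[set t in st_terminals I | connect (arc_rel S) v t]|
          <= capacity (st_graph I) (u, v)].
Arguments steiner_feasible : clear implicits.

Definition tree_length (I : steiner_instance)
    (S : {set 'I_(st_n I) * 'I_(st_n I)}) : rat :=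
  (\sum_(a in S) len (st_graph I) a)%R.
Arguments tree_length : clear implicits.

Definition steiner_optimal (I : steiner_instance)
    (S : {set 'I_(st_n I) * 'I_(st_n I)}) : Prop :=
  steiner_feasible I S /\
  forall S', steiner_feasible I S' -> (tree_length I S <= tree_length I S')%R.
Arguments steiner_optimal : clear implicits.

Definition enc_arc n (a : 'I_n * 'I_n) : data :=
  Pair (enc_ord a.1) (enc_ord a.2).

(* The arcs of an optimal tree may be listed in any order. *)
Definition steiner_answers (I : steiner_instance) (y : data) : Prop :=
  (exists s : seq ('I_(st_n I) * 'I_(st_n I)),
     [/\ uniq s,
         steiner_optimal I [set a in s] &
         y = enc_option (enc_list (@enc_arc (st_n I))) (Some s)]) \/
  ((forall S, ~ steiner_feasible I S) /\
   y = enc_option (enc_list (@enc_arc (st_n I))) None).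

Definition ML_CAP_STEINER_TREE (directed : bool) (K : nat) : problem :=
  Problem (steiner_valid directed K) enc_steiner steiner_answers.

(** * ML-LAB-VDISJ-PATH *)

(* The [vd_k] labels are numbered from 0. *)
Record vdisj_instance : Type := VdisjInstance {
  vd_n : nat;
  vd_k : nat;
  vd_graph : 'M[option (rat * 'I_vd_k)]_vd_n;
  vd_p : nat;
  vd_source : {ffun 'I_vd_p -> 'I_vd_n};
  vd_sink : {ffun 'I_vd_p -> 'I_vd_n};
  vd_labels : {ffun 'I_vd_p -> {set 'I_vd_k}}
}.

(* The [2 * vd_p] sources and sinks are pairwise distinct. *)
Definition vdisj_valid (directed : bool) (q : nat) (J : vdisj_instance) : Prop :=
  [/\ simple_graph directed (vd_graph J),
      nonneg_lengths (vd_graph J),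
      0 < vd_k J,
      vd_p J <= q &
      [/\ injective (vd_source J),
          injective (vd_sink J) &
          forall i j, vd_source J i != vd_sink J j]].

Definition enc_vdisj (J : vdisj_instance) : data :=
  Pair (Num (vd_n J))
    (Pair (Num (vd_k J))
       (Pair (enc_graph (@enc_ord (vd_k J)) (vd_graph J))
          (enc_list
             (fun i => Pair (Pair (enc_ord (vd_source J i))
                                  (enc_ord (vd_sink J i)))
                            (enc_set (vd_labels J i)))
             (enum 'I_(vd_p J))))).

Definition path_arcs n (mu : seq 'I_n) : seq ('I_n * 'I_n) :=
  zip mu (behead mu).

Definition links n (e : rel 'I_n) (s s' : 'I_n) (mu : seq 'I_n) : bool :=
  if mu is x :: m then [&& x == s, last x m == s', path e x m & uniq mu]
  else false.

Definition has_label_in n k (G : 'M[option (rat * 'I_k)]_n) (L : {set 'I_k})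
    (a : 'I_n * 'I_n) : bool :=
  if G a.1 a.2 is Some e then e.2 \in L else false.

Definition vdisj_feasible (J : vdisj_instance)
    (mu : {ffun 'I_(vd_p J) -> seq 'I_(vd_n J)}) : Prop :=
  [/\ forall i, links (adj (vd_graph J)) (vd_source J i) (vd_sink J i) (mu i),
      forall i, all (has_label_in (vd_graph J) (vd_labels J i))
                    (path_arcs (mu i)) &
      forall i j, i != j -> [disjoint mu i & mu j]].
Arguments vdisj_feasible : clear implicits.

Definition paths_length (J : vdisj_instance)
    (mu : {ffun 'I_(vd_p J) -> seq 'I_(vd_n J)}) : rat :=
  (\sum_(i < vd_p J) \sum_(a <- path_arcs (mu i)) len (vd_graph J) a)%R.
Arguments paths_length : clear implicits.

Definition vdisj_optimal (J : vdisj_instance)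
    (mu : {ffun 'I_(vd_p J) -> seq 'I_(vd_n J)}) : Prop :=
  vdisj_feasible J mu /\
  forall mu', vdisj_feasible J mu' -> (paths_length J mu <= paths_length J mu')%R.
Arguments vdisj_optimal : clear implicits.

Definition enc_paths (J : vdisj_instance)
    (mu : {ffun 'I_(vd_p J) -> seq 'I_(vd_n J)}) : data :=
  enc_list (fun i => enc_list (@enc_ord (vd_n J)) (mu i)) (enum 'I_(vd_p J)).
Arguments enc_paths : clear implicits.

Definition vdisj_answers (J : vdisj_instance) (y : data) : Prop :=
  (exists mu, vdisj_optimal J mu /\ y = enc_option (enc_paths J) (Some mu)) \/
  ((forall mu, ~ vdisj_feasible J mu) /\ y = enc_option (enc_paths J) None).

(* Restricted to the instances with at most [q] source-sink pairs. *)
Definition ML_LAB_VDISJ_PATH (directed : bool) (q : nat) : problem :=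
  Problem (vdisj_valid directed q) enc_vdisj vdisj_answers.

(* Main.v *)
Require Import Defs.
From mathcomp Require Import all_boot all_order all_algebra zify.

Set Implicit Arguments.
Unset Strict Implicit.
Unset Printing Implicit Defensive.

Import Order.TTheory GRing.Theory Num.Theory.

(** In a feasible tree [S], let [D v] be the set of terminals below [v].  The
    vertices [v] with a given nonempty [D v] form a path of [S]; call its lowest
    vertex a key vertex.  Terminals are key vertices, distinct key vertices have
    distinct sets [D v], so there are at most [2 ^ K] of them, and [S] (up to arcs
    that serve no terminal) is the union of the paths joining each key vertex to
    the next key vertex above it, or to the root.  These paths are disjoint except
    at their ends, and all arcs of a path carry the same number of terminals.

    Conversely, guess the parent relation between the key vertices together with
    the sets [D v] (finitely many possibilities for fixed [K]) and the key
    vertices themselves (polynomially many).  Delete the key vertices and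
    replace each by one copy per incident path of the skeleton; label every edge by
    its capacity, truncated at [K], and allow on each path the labels that are at
    least its number of terminals.  Disjoint paths between the copies then
    collapse to a feasible tree of the same length, and the best of all these
    trees is optimal. *)

(** * Polynomial-time programs *)

(* Plain data types with the encoding of [Defs], so that the encodings of both
   problems are instances of [enc] and programs are written as ordinary functions
   between such types. *)

(** The number of shapes depends on [K] only, so the loop over shapes is unrolled inside the
    program: [raw_shapes] is one of its constants, and only the placements of the key vertices are
    enumerated at run time, among at most n^m tuples with m at most 2^K. All queries are computed
    before the first one is asked; the program is thus an oracle-free part, a loop of queries and
    another oracle-free part, and only the loop has to be analysed with an oracle. Reading an answer
    is charged, so answers must be short: they are, because the paths are simple. Copies of the key
    vertices are needed because the paths must be disjoint including their ends, whereas paths of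
    the skeleton meet at key vertices. Truncating capacities at [K] loses nothing, since no arc
    carries more than [K] terminals, and it keeps the set of labels fixed. A guess need not describe
    exactly the tree that it produces: the guessed sets only bound the true sets of terminals from
    above. *)

Structure encType := EncType { ecar :> Type; encode_in : ecar -> data }.

Definition enc (A : encType) (x : A) : data := encode_in x.

Canonical nat_encType := EncType Defs.Num.
Canonical bool_encType := EncType (fun b : bool => Defs.Num b).
Canonical prod_encType (A B : encType) :=
  EncType (fun x : A * B => Pair (enc x.1) (enc x.2)).
Canonical seq_encType (A : encType) := EncType (enc_list (@enc A)).
Canonical option_encType (A : encType) := EncType (enc_option (@enc A)).

Definition sz (A : encType) (x : A) : nat := dsize (enc x).

Lemma dsize_gt0 x : 0 < dsize x. Proof. by case: x. Qed.

Lemma sz_gt0 (A : encType) (x : A) : 0 < sz x.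
Proof. exact: dsize_gt0. Qed.

Lemma sz_pair (A B : encType) (x : A) (y : B) :
  sz (x, y) = (sz x + sz y).+1.
Proof. by []. Qed.

Lemma sz_cons (A : encType) (x : A) s : sz (x :: s) = (sz x + sz s).+1.
Proof. by []. Qed.

Lemma enc_someE (A : encType) (x : A) : enc (Some x) = Pair (enc x) (enc 0).
Proof. by []. Qed.

Lemma sz_some (A : encType) (x : A) : sz (Some x) = (sz x).+2.
Proof. by rewrite /sz enc_someE /= addn1. Qed.

(** * Polynomial bounds in the size of the input *)

Definition pbound (A : encType) (f : A -> nat) : Prop :=
  exists a d, forall x, f x <= a * sz x ^ d.

Section Pbound.
Context {A : encType}.
Implicit Types f g : A -> nat.

Lemma pb_le f g : (forall x, f x <= g x) -> pbound g -> pbound f.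
Proof.
by move=> le_fg [a [d H]]; exists a, d => x; apply: leq_trans (le_fg x) (H x).
Qed.

Lemma pb_cst c : pbound (fun _ : A => c).
Proof. by exists c, 0 => x; rewrite muln1. Qed.

Lemma pb_sz : pbound (fun x : A => sz x).
Proof. by exists 1, 1 => x; rewrite mul1n. Qed.

Lemma pb_add f g : pbound f -> pbound g -> pbound (fun x => f x + g x).
Proof.
move=> [a [d Hf]] [b [e Hg]]; exists (a + b), (d + e) => x.
rewrite mulnDl leq_add //.
  by apply: leq_trans (Hf x) _; rewrite leq_mul // leq_pexp2l ?sz_gt0 ?leq_addr.
by apply: leq_trans (Hg x) _; rewrite leq_mul // leq_pexp2l ?sz_gt0 ?leq_addl.
Qed.

Lemma pb_mul f g : pbound f -> pbound g -> pbound (fun x => f x * g x).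
Proof.
move=> [a [d Hf]] [b [e Hg]]; exists (a * b), (d + e) => x.
by rewrite expnD mulnACA leq_mul.
Qed.

Lemma pb_succ f : pbound f -> pbound (fun x => (f x).+1).
Proof.
move=> Hf; apply: (@pb_le _ (fun x => f x + 1)) => [x|]; first by rewrite addn1.
exact: pb_add Hf (pb_cst 1).
Qed.

Lemma pb_comp (B : encType) (h : A -> B) (f : B -> nat) :
  pbound (fun x => sz (h x)) -> pbound f -> pbound (fun x => f (h x)).
Proof.
move=> [a [d Hh]] [b [e Hf]]; exists (b * a ^ e), (d * e) => x.
apply: leq_trans (Hf _) _; rewrite -mulnA leq_mul //.
(* Exponent 0 is split off because [leq_exp2r] needs a positive exponent; the same split recurs
   below. *)
by rewrite expnM -expnMn; case: e {Hf} => // e; rewrite leq_exp2r.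
Qed.

(** Serves branches whose inner input [y] exists for some [x] only, as in [pt_ocase], where
    [pb_comp] would require a total function. *)
Lemma pb_sub (B : encType) (tau : B -> nat) (f w : A -> nat) :
  pbound tau -> pbound w ->
  (forall x, f x = 0 \/ exists2 y, f x <= tau y & sz y <= w x) -> pbound f.
Proof.
move=> [b [e Hb]] [a [d Ha]] H; exists (b * a ^ e), (d * e) => x.
have [->//|[y le_f le_w]] := H x.
apply: leq_trans le_f _; apply: leq_trans (Hb _) _; rewrite -mulnA leq_mul //.
rewrite expnM -expnMn; case: e {Hb} => // e.
by rewrite leq_exp2r // (leq_trans le_w).
Qed.

End Pbound.

(* An oracle-free program: its correctness is required for every [O]. *)
Definition ptime (A B : encType) (f : A -> B) : Prop :=
  exists p tau, pbound tau /\
    forall O x, exists2 t, eval O p (enc x) (enc (f x)) t & t <= tau x.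

(** Every result is paid for in the cost ([eval_size]), so a cost bound also bounds the output; this
    is what makes [pt_comp] work without a growth hypothesis. *)
Lemma pt_size (A B : encType) (f : A -> B) :
  ptime f -> pbound (fun x => sz (f x)).
Proof.
move=> [p [tau [Htau H]]]; apply: pb_le Htau => x.
(* The program is correct for every oracle, so the empty one will do. *)
have [t e le_t] := H (fun=> None) x.
exact: leq_trans (eval_size e).2 le_t.
Qed.

(** * Closure properties of polynomial-time functions *)

Section Elementary.
Context {A B : encType}.

Lemma pt_ext (f g : A -> B) : f =1 g -> ptime f -> ptime g.
Proof.
move=> fg [p [tau [Htau H]]]; exists p, tau; split=> // O x.
by have [t e le_t] := H O x; exists t; rewrite -?fg.
Qed.

Lemma pt_prim (a : prim) (f : A -> B) (bnd : A -> nat) :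
  (forall x, prim_sem a (enc x) = enc (f x)) ->
  (forall x, sz (f x) <= bnd x) -> pbound bnd -> ptime f.
Proof.
move=> Hf le_b Hb; exists (Prim a), (fun x => sz x + bnd x).
split=> [|O x]; first exact: pb_add pb_sz Hb.
exists (sz x + sz (f x)); last by rewrite leq_add2l.
by rewrite /sz -Hf; apply: EvalPrim.
Qed.

End Elementary.

Section Composition.
Context {A B C : encType}.

Lemma pt_id : ptime (fun x : A => x).
Proof. by apply: (pt_prim (a := Id) (bnd := fun x => sz x)) => //; apply: pb_sz. Qed.

Lemma pt_cst (y : B) : ptime (fun _ : A => y).
Proof.
by apply: (pt_prim (a := Const (enc y)) (bnd := fun=> sz y)) => //; apply: pb_cst.
Qed.

Lemma pt_comp (f : A -> B) (g : B -> C) :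
  ptime f -> ptime g -> ptime (fun x => g (f x)).
Proof.
move=> Pf [q [sig [Hsig Hg]]]; have Hs := pt_size Pf.
move: Pf => [p [tau [Htau Hf]]].
exists (Seq p q), (fun x => tau x + sig (f x)); split=> [|O x].
  exact: pb_add Htau (pb_comp Hs Hsig).
have [t et le_t] := Hf O x; have [u eu le_u] := Hg O (f x).
by exists (t + u); [apply: EvalSeq et eu | apply: leq_add].
Qed.

Lemma pt_pair (f : A -> B) (g : A -> C) :
  ptime f -> ptime g -> ptime (fun x => (f x, g x)).
Proof.
move=> [p [tau [Htau Hf]]] [q [sig [Hsig Hg]]].
exists (Fork p q), (fun x => (tau x + sig x).+1); split=> [|O x].
  exact: pb_succ (pb_add Htau Hsig).
have [t et le_t] := Hf O x; have [u eu le_u] := Hg O x.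
by exists (t + u).+1; [apply: EvalFork et eu | apply: leq_add].
Qed.

Lemma pt_if (b : A -> bool) (f g : A -> B) :
  ptime b -> ptime f -> ptime g -> ptime (fun x => if b x then f x else g x).
Proof.
move=> [r [rho [Hrho Hb]]] [p [tau [Htau Hf]]] [q [sig [Hsig Hg]]].
exists (If r p q), (fun x => (rho x + (tau x + sig x)).+1); split=> [|O x].
  exact: pb_succ (pb_add Hrho (pb_add Htau Hsig)).
have [t et le_t] := Hf O x; have [u eu le_u] := Hg O x.
have [v + le_v] := Hb O x; case: (b x) => ev.
  by exists (v + t).+1; [apply: EvalIfTrue ev isT et | lia].
by exists (v + u).+1; [apply: EvalIfFalse ev isT eu | lia].
Qed.

End Composition.

Section Destructors.
Context {A B C D : encType}.

Lemma pt_fst (f : A -> B * C) : ptime f -> ptime (fun x => (f x).1).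
Proof.
move=> Pf; apply: (pt_comp Pf).
by apply: (pt_prim (a := Fst) (bnd := fun x => sz x)) => [//|x|];
   [rewrite /sz /=; lia | apply: pb_sz].
Qed.

Lemma pt_snd (f : A -> B * C) : ptime f -> ptime (fun x => (f x).2).
Proof.
move=> Pf; apply: (pt_comp Pf).
by apply: (pt_prim (a := Snd) (bnd := fun x => sz x)) => [//|x|];
   [rewrite /sz /=; lia | apply: pb_sz].
Qed.

(** A cons cell and a pair have the same encoding, so the program for the pair is reused as it
    is. *)
Lemma pt_cons (f : A -> B) (g : A -> seq B) :
  ptime f -> ptime g -> ptime (fun x => f x :: g x).
Proof.
move=> Pf Pg; have [p [tau [Ht H]]] := pt_pair Pf Pg.
by exists p, tau; split.
Qed.

Lemma pt_some (f : A -> B) : ptime f -> ptime (fun x => Some (f x)).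
Proof.
move=> Pf; have [p [tau [Ht H]]] := pt_pair Pf (pt_cst 0).
by exists p, tau; split.
Qed.

(** [Some] is encoded by a pair and [None] by a number, so [IsPair] decides the case. *)
Lemma pt_ocase (o : A -> option B) (f : A -> B -> C) (g : A -> C) :
  ptime o -> ptime (fun z : A * B => f z.1 z.2) -> ptime g ->
  ptime (fun x => if o x is Some y then f x y else g x).
Proof.
move=> Po; have Hso := pt_size Po.
move: Po => [r [rho [Hrho Ho]]] [p [tau [Htau Hf]]] [q [sig [Hsig Hg]]].
(* The cost [tau] is counted only when the [Some] branch is taken. *)
pose tau' x := if o x is Some y then tau (x, y) else 0.
have Htau' : pbound tau'.
  apply: (@pb_sub _ _ tau _ (fun x => (sz x + sz (o x)).+1)) => // [|x].
    exact: pb_succ (pb_add pb_sz Hso).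
  rewrite /tau'; case: (o x) => [y|]; last by left.
  by right; exists (x, y); rewrite // sz_pair /sz /=; lia.
(* [r] runs once for the test and once more to build the pair [(x, y)]. *)
exists (If (Seq r (Prim IsPair))
          (Seq (Fork (Prim Id) (Seq r (Prim Fst))) p) q).
exists (fun x => 4 * (rho x + sz x + sz (o x)) + tau' x + sig x + 9).
split=> [|O x].
  by do ![apply: pb_add | apply: pb_mul | apply: pb_cst | apply: pb_sz].
have [u eu le_u] := Hg O x; have [v] := Ho O x; rewrite /tau' /sz.
case: (o x) => [y|] ev le_v.
  have [t et le_t] := Hf O (x, y).
  eexists; first apply: EvalIfTrue; first by apply: EvalSeq ev (EvalPrim _ _ _).
  - by [].
  - by apply: EvalSeq et; apply: EvalFork (EvalPrim _ _ _) (EvalSeq ev (EvalPrim _ _ _)).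
  by rewrite enc_someE /= trunc_log0 trunc_log1; lia.
eexists; first apply: EvalIfFalse; first by apply: EvalSeq ev (EvalPrim _ _ _).
- by [].
- exact: eu.
by rewrite /=; lia.
Qed.

End Destructors.

(** * Arithmetic on binary numbers *)

Lemma ltn_sz (n : nat) : n < 2 ^ sz n.
Proof. exact: trunc_log_ltn. Qed.

Lemma leq_sz (n k : nat) : 0 < k -> n < 2 ^ k -> sz n <= k.
Proof.
move=> k_gt0 lt_n; case: (posnP n) => [->|n_gt0] //; rewrite /sz /= ltnNge.
apply/negP => le_k; have := trunc_logP (isT : 1 < 2) n_gt0.
by rewrite leqNgt (leq_trans lt_n) // leq_exp2l.
Qed.

Lemma sz_mono (m n : nat) : m <= n -> sz m <= sz n.
Proof. by move=> le_mn; apply: leq_sz => //; apply: leq_ltn_trans (ltn_sz n). Qed.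

Lemma sz_bool (b : bool) : sz b = 1. Proof. by case: b. Qed.

Lemma sz_succ (n : nat) : sz n.+1 <= (sz n).+1.
Proof. by apply: leq_sz => //; have := ltn_sz n; rewrite expnS; lia. Qed.

Lemma sz_le (n : nat) : sz n <= n.+1.
Proof. by elim: n => // n IHn; apply: leq_trans (sz_succ n) _. Qed.

Lemma sz_add (m n : nat) : sz (m + n) <= sz m + sz n.
Proof.
apply: leq_sz; first by rewrite ltn_addr ?sz_gt0.
have := ltn_sz m; have := ltn_sz n.
have: 0 < sz m by exact: sz_gt0.
have: 0 < sz n by exact: sz_gt0.
move: (sz m) (sz n) => [|a] [|b] //;  rewrite addSn addnS !expnS expnD.
have := expn_gt0 2 a; have := expn_gt0 2 b.
by move: (2 ^ a) (2 ^ b) => /= x y; nia.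
Qed.

Lemma sz_mul (m n : nat) : sz (m * n) <= sz m + sz n.
Proof.
apply: leq_sz; first by rewrite ltn_addr ?sz_gt0.
by rewrite expnD ltn_mul ?ltn_sz.
Qed.

Section Arith.
Context {A : encType}.
Implicit Types (f g : A -> nat) (b c : A -> bool).

Lemma pt_nat2 (B : encType) (a : prim) (op : nat -> nat -> B) f g :
  (forall m n, prim_sem a (enc (m, n)) = enc (op m n)) ->
  (forall m n, sz (op m n) <= sz m + sz n) ->
  ptime f -> ptime g -> ptime (fun x => op (f x) (g x)).
Proof.
move=> Ha Hsz Pf Pg; apply: (pt_comp (pt_pair Pf Pg) (g := fun z => op z.1 z.2)).
apply: (pt_prim (a := a) (bnd := fun x => sz x)); last exact: pb_sz.
  by move=> [m n]; rewrite Ha.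
by move=> [m n]; apply: leq_trans (Hsz _ _) _; rewrite sz_pair leqnSn.
Qed.

Lemma pt_add f g : ptime f -> ptime g -> ptime (fun x => f x + g x).
Proof. by apply: (pt_nat2 (a := Add)) => // m n; apply: sz_add. Qed.

Lemma pt_mul f g : ptime f -> ptime g -> ptime (fun x => f x * g x).
Proof. by apply: (pt_nat2 (a := Mul)) => // m n; apply: sz_mul. Qed.

Lemma pt_leq f g : ptime f -> ptime g -> ptime (fun x => f x <= g x).
Proof.
apply: (pt_nat2 (a := Leq)) => // m n; rewrite sz_bool.
by rewrite addn_gt0 sz_gt0.
Qed.

Lemma pt_succ f : ptime f -> ptime (fun x => (f x).+1).
Proof. by move=> Pf; apply: pt_ext (pt_add Pf (pt_cst 1)) => x; rewrite addn1. Qed.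

Lemma pt_neg b : ptime b -> ptime (fun x => ~~ b x).
Proof. by move=> Pb; apply: pt_if Pb (pt_cst false) (pt_cst true). Qed.

Lemma pt_and b c : ptime b -> ptime c -> ptime (fun x => b x && c x).
Proof. by move=> Pb Pc; apply: pt_if Pb Pc (pt_cst false). Qed.

Lemma pt_eqn f g : ptime f -> ptime g -> ptime (fun x => f x == g x).
Proof.
move=> Pf Pg; apply: pt_ext (pt_and (pt_leq Pf Pg) (pt_leq Pg Pf)) => x.
by rewrite eqn_leq.
Qed.

Lemma pt_minn f g : ptime f -> ptime g -> ptime (fun x => minn (f x) (g x)).
Proof.
move=> Pf Pg; apply: pt_ext (pt_if (pt_leq Pf Pg) Pf Pg) => x.
by case: leqP.
Qed.

End Arith.

(** * A loop over a list *)

Section Fold.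

(* The state of the loop is [Pair context (Pair accumulator remaining_list)]. *)
Definition fold_loop (p : prog) : prog :=
  While (Seq (Prim Snd) (Seq (Prim Snd) (Prim IsPair)))
    (Fork (Prim Fst)
       (Fork (Seq (Fork (Prim Fst)
                     (Fork (Seq (Prim Snd) (Prim Fst))
                           (Seq (Prim Snd) (Seq (Prim Snd) (Prim Fst))))) p)
             (Seq (Prim Snd) (Seq (Prim Snd) (Prim Snd))))).

Definition fold_prog (p : prog) : prog :=
  Seq (fold_loop p) (Seq (Prim Snd) (Prim Fst)).

(** The step is assumed to work only at the accumulators actually reached, that is after a prefix of
    [ys]. The query loop depends on this, since the oracle is only known on the queries in the list.
    The size bound in the conclusion comes from [eval_size] applied to the steps. *)
Lemma eval_while O p (c : data) Y B (eY : Y -> data) (eB : B -> data)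
    (g : B -> Y -> B) (ys : seq Y) (b : B) (tau : nat) :
  (forall ys1 y ys2, ys = ys1 ++ y :: ys2 ->
     exists2 t,
       eval O p (Pair c (Pair (eB (foldl g b ys1)) (eY y)))
                (eB (g (foldl g b ys1) y)) t & t <= tau) ->
  dsize (eB b) <= tau ->
  exists2 t,
    eval O (fold_loop p) (Pair c (Pair (eB b) (enc_list eY ys)))
           (Pair c (Pair (eB (foldl g b ys)) (Defs.Num 0))) t &
    t <= 40 * (size ys).+1 * (dsize c + dsize (enc_list eY ys) + tau + 1) /\
    dsize (eB (foldl g b ys)) <= tau.
Proof.
elim: ys b => [|y ys IHys] b Hstep le_b.
  eexists; first apply: EvalWhileDone.
  - exact: EvalSeq (EvalPrim _ _ _) (EvalSeq (EvalPrim _ _ _) (EvalPrim _ _ _)).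
  - by [].
  by rewrite /= trunc_log0; have := dsize_gt0 c; lia.
have [v ev le_v] := Hstep [::] y ys erefl.
have [_ /= le_b'] := eval_size ev.
have [||u eu [le_u le_f]] := IHys (g b y).
- move=> ys1 y' ys2 def_ys; have [|u eu le_u] := Hstep (y :: ys1) y' ys2.
    by rewrite def_ys.
  by exists u.
- exact: leq_trans le_b' le_v.
eexists; first apply: EvalWhileStep eu.
- exact: EvalSeq (EvalPrim _ _ _) (EvalSeq (EvalPrim _ _ _) (EvalPrim _ _ _)).
- by [].
- apply: EvalFork (EvalPrim _ _ _) _.
  apply: EvalFork; last first.
    exact: EvalSeq (EvalPrim _ _ _) (EvalSeq (EvalPrim _ _ _) (EvalPrim _ _ _)).
  apply: EvalSeq ev; apply: EvalFork (EvalPrim _ _ _) _.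
  apply: EvalFork; first exact: EvalSeq (EvalPrim _ _ _) (EvalPrim _ _ _).
  exact: EvalSeq (EvalPrim _ _ _) (EvalSeq (EvalPrim _ _ _) (EvalPrim _ _ _)).
split=> //; rewrite /= trunc_log1.
move: le_u; rewrite -!mulnA.
set X' := dsize c + _ + _ + 1; set X := dsize c + _ + _ + 1.
have le_X : X' <= X by rewrite /X /X' /=; lia.
have : (size ys).+1 * X' <= (size ys).+1 * X by rewrite leq_mul.
rewrite (mulSn (size ys).+1).
set Z' := _ * X'; set Z := _ * X; move=> le_Z le_u.
move: le_X; rewrite /X /X' /=.
have := dsize_gt0 c; have := dsize_gt0 (enc_list eY ys).
have := dsize_gt0 (eY y); have := dsize_gt0 (eB b).
by lia.
Qed.

Lemma eval_fold O p (c : data) Y B (eY : Y -> data) (eB : B -> data)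
    (g : B -> Y -> B) (ys : seq Y) (b : B) (tau : nat) :
  (forall ys1 y ys2, ys = ys1 ++ y :: ys2 ->
     exists2 t,
       eval O p (Pair c (Pair (eB (foldl g b ys1)) (eY y)))
                (eB (g (foldl g b ys1) y)) t & t <= tau) ->
  dsize (eB b) <= tau ->
  exists2 t,
    eval O (fold_prog p) (Pair c (Pair (eB b) (enc_list eY ys)))
           (eB (foldl g b ys)) t &
    t <= 50 * (size ys).+1 * (dsize c + dsize (enc_list eY ys) + tau + 1).
Proof.
move=> Hstep le_b; have [t et [le_t le_f]] := eval_while Hstep le_b.
eexists; first exact: EvalSeq et (EvalSeq (EvalPrim _ _ _) (EvalPrim _ _ _)).
rewrite /= trunc_log0; move: le_t; rewrite -!mulnA.
set X := dsize c + _ + _ + _; set Z := _ * X; move=> le_t.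
have : X <= Z by rewrite leq_pmull.
have := dsize_gt0 c; have := dsize_gt0 (enc_list eY ys).
by rewrite /X; lia.
Qed.

End Fold.

(** * List functions in polynomial time *)

Lemma pb_exp (A : encType) (f : A -> nat) d :
  pbound f -> pbound (fun x => f x ^ d).
Proof.
move=> Hf; elim: d => [|d IHd]; first exact: pb_cst.
by apply: pb_le (pb_mul Hf IHd) => x; rewrite expnS.
Qed.

Lemma size_le_sz (A : encType) (s : seq A) : size s < sz s.
Proof. by elim: s => // x s IHs; rewrite sz_cons /= ltnS ltn_addl. Qed.

Lemma sz_catl (A : encType) (s1 s2 : seq A) : sz s1 <= sz (s1 ++ s2).
Proof. by elim: s1 => [|x s1 IHs]; rewrite ?sz_gt0 // cat_cons !sz_cons; lia. Qed.

Lemma sz_catr (A : encType) (s1 s2 : seq A) : sz s2 <= sz (s1 ++ s2).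
Proof. by elim: s1 => // x s1 IHs; rewrite cat_cons sz_cons; lia. Qed.

Lemma sz_cat (A : encType) (s1 s2 : seq A) : sz (s1 ++ s2) <= sz s1 + sz s2.
Proof. by elim: s1 => [|x s1 IHs]; rewrite ?leq_addl // cat_cons !sz_cons; lia. Qed.

Ltac pb := repeat first
  [ assumption | apply: pb_cst | apply: pb_sz | apply: pb_mul
  | apply: pb_add | apply: pb_exp | apply: pb_succ ].

Section Foldl.
Context {A Y B : encType}.
Variables (g : A -> B -> Y -> B) (h : A -> B).

(** A polynomial step may blow up when iterated (repeated squaring), hence the separate bound on the
    accumulator. It ranges over all lists, so that it applies to the prefixes of [l x] and thereby
    to the intermediate accumulators. *)
Lemma pt_foldl (l : A -> seq Y) :
  ptime (fun z : A * (B * Y) => g z.1 z.2.1 z.2.2) -> ptime h -> ptime l ->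
  pbound (fun z : A * seq Y => sz (foldl (g z.1) (h z.1) z.2)) ->
  ptime (fun x => foldl (g x) (h x) (l x)).
Proof.
move=> [p [tau [[b [e Htau]] Hp]]] Ph Pl [a [d Hsz]].
have Hsh := pt_size Ph; have Hsl := pt_size Pl.
have [q [rho [Hrho Hq]]] := pt_pair pt_id (pt_pair Ph Pl).
(* [w x] bounds the input of one step: the context, an intermediate accumulator and a list entry. *)
pose w x := sz x + a * (sz x + sz (l x)).+1 ^ d + sz (l x) + 3.
pose bd x := b * w x ^ e + sz (h x).
exists (Seq q (fold_prog p)).
exists (fun x => rho x +
  50 * (size (l x)).+1 * (sz x + sz (l x) + bd x + 1)).
split=> [|O x].
  apply: (@pb_le _ _ (fun x => rho x + 50 * sz (l x) * (sz x + sz (l x) + bd x + 1))).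
    by move=> x; rewrite leq_add2l leq_mul // leq_mul // size_le_sz.
  by rewrite /bd /w; pb.
have [t et le_t] := Hq O x.
have [ys1 y ys2 def_l||u eu le_u] :=
  @eval_fold O p (enc x) Y B (@enc Y) (@enc B) (g x) (l x) (h x) (bd x).
- set b1 := foldl _ _ _; have [u eu le_u] := Hp O (x, (b1, y)).
  exists u; first exact: eu.
  apply: leq_trans le_u _; apply: leq_trans (Htau _) _.
  rewrite /bd -[leqLHS]addn0 leq_add // leq_mul //.
  case: e {Htau bd} => // e; rewrite leq_exp2r // /w !sz_pair.
  have le1 : sz b1 <= a * (sz x + sz (l x)).+1 ^ d.
    apply: leq_trans (Hsz (x, ys1)) _; rewrite leq_mul //.
    case: (d) => // d'; rewrite leq_exp2r // sz_pair ltnS leq_add2l def_l.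
    exact: sz_catl.
  have le2 : sz y < sz (l x).
    rewrite def_l; apply: leq_trans (sz_catr _ _); rewrite sz_cons.
    by have := sz_gt0 ys2; lia.
  by lia.
- by rewrite /bd leq_addl.
exists (t + u); first exact: EvalSeq et eu.
exact: leq_add.
Qed.

(** A step that enlarges the accumulator by an amount independent of it leads to linear growth in
    the number of steps. *)
Lemma pb_foldl (ex : A -> Y -> nat) :
  (forall x b y, sz (g x b y) <= sz b + ex x y) ->
  pbound (fun z : A * Y => ex z.1 z.2) -> pbound (fun x => sz (h x)) ->
  pbound (fun z : A * seq Y => sz (foldl (g z.1) (h z.1) z.2)).
Proof.
move=> Hg [a [d Hex]] Hh.
apply: (@pb_le _ _ (fun z => sz (h z.1) + sz z * (a * sz z ^ d))) => [[x ys]|].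
  suff H s1 b : sz s1 <= sz ys -> sz (foldl (g x) b s1) <=
      sz b + size s1 * (a * sz (x, ys) ^ d).
    apply: leq_trans (H _ _ (leqnn _)) _; rewrite leq_add2l leq_mul //.
    by rewrite sz_pair; have := size_le_sz ys; lia.
  elim: s1 b => [|y s1 IHs] b /=; first by rewrite addn0.
  rewrite sz_cons => le_s; apply: leq_trans (IHs _ _) _; first by lia.
  apply: leq_trans (leq_add (Hg _ _ _) (leqnn _)) _.
  rewrite mulSn addnA leq_add2r leq_add2l.
  apply: leq_trans (Hex (x, y)) _; rewrite leq_mul //.
  by case: (d) => // d'; rewrite leq_exp2r // !sz_pair; lia.
apply: pb_add; last by pb.
apply: (pb_comp (h := fun z : A * seq Y => z.1) (f := fun x => sz (h x))) Hh.
by apply: pb_le (@pb_sz _) => -[x y]; rewrite sz_pair /=; lia.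
Qed.

End Foldl.

Lemma pt_app2 (A B C D : encType) (f : B -> C -> D) (g : A -> B) (h : A -> C) :
  ptime (fun z : B * C => f z.1 z.2) -> ptime g -> ptime h ->
  ptime (fun x => f (g x) (h x)).
Proof.
move=> Pf Pg Ph.
exact: (pt_comp (g := fun z : B * C => f z.1 z.2) (pt_pair Pg Ph) Pf).
Qed.

Section Reverse.
Context {A Y : encType}.

Lemma pt_catrev (f g : A -> seq Y) :
  ptime f -> ptime g -> ptime (fun x => catrev (f x) (g x)).
Proof.
move=> Pf Pg; apply: (@pt_ext _ _ (fun x => foldl (fun s y => y :: s) (g x) (f x))).
  by move=> x; elim: (f x) (g x) => //= y s IHs t; rewrite IHs.
apply: pt_foldl => //.
  apply: pt_cons; first exact: pt_snd (pt_snd pt_id).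
  exact: pt_fst (pt_snd pt_id).
apply: (@pb_foldl _ _ _ (fun _ s y => y :: s) _ (fun _ y => (sz y).+1)) => [_ b y||].
- by rewrite sz_cons; lia.
- by apply: pb_succ; apply: pt_size (pt_snd pt_id).
- exact: pt_size.
Qed.

Lemma pt_rev (f : A -> seq Y) : ptime f -> ptime (fun x => rev (f x)).
Proof. by move=> Pf; apply: pt_catrev Pf (pt_cst [::]). Qed.

End Reverse.

Section Lists.
Context {A Y Z : encType}.

Lemma pt_map (f : A -> Y -> Z) (l : A -> seq Y) :
  ptime (fun z : A * Y => f z.1 z.2) -> ptime l ->
  ptime (fun x => [seq f x y | y <- l x]).
Proof.
move=> Pf Pl.
apply: (@pt_ext _ _ (fun x => rev (foldl (fun s y => f x y :: s) [::] (l x)))).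
  move=> x; rewrite -[RHS]cat0s -[[::] in RHS]/(rev [::]).
  elim: (l x) [::] => [|y s IHs] t /=; first by rewrite cats0.
  by rewrite IHs rev_cons cat_rcons.
apply: pt_rev; apply: pt_foldl => //.
- apply: pt_cons; last exact: pt_fst (pt_snd pt_id).
  exact: pt_app2 Pf (pt_fst pt_id) (pt_snd (pt_snd pt_id)).
- exact: pt_cst.
apply: (@pb_foldl _ _ _ (fun x s y => f x y :: s) (fun=> [::])
  (fun x y => (sz (f x y)).+1)).
- by move=> x b y; rewrite sz_cons; lia.
- exact: pb_succ (pt_size Pf).
- exact: pb_cst.
Qed.

Lemma pt_all (f : A -> Y -> bool) (l : A -> seq Y) :
  ptime (fun z : A * Y => f z.1 z.2) -> ptime l ->
  ptime (fun x => all (f x) (l x)).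
Proof.
move=> Pf Pl.
apply: (@pt_ext _ _ (fun x => foldl (fun b y => b && f x y) true (l x))).
  move=> x; rewrite -[RHS]andTb; elim: (l x) true => [|y s IHs] b /=.
    by rewrite andbT.
  by rewrite IHs andbA.
apply: pt_foldl => //.
- apply: pt_and; first exact: pt_fst (pt_snd pt_id).
  exact: pt_app2 Pf (pt_fst pt_id) (pt_snd (pt_snd pt_id)).
- exact: pt_cst.
by apply: pb_le (pb_cst 1) => z; rewrite sz_bool.
Qed.

Lemma pt_nth (d : Y) (l : A -> seq Y) (i : A -> nat) :
  ptime l -> ptime i -> ptime (fun x => nth d (l x) (i x)).
Proof.
move=> Pl Pi.
(* The state is the current index and the entry found so far; the whole list is scanned. *)
pose g x (b : nat * Y) y := (b.1.+1, if b.1 == i x then y else b.2).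
apply: (@pt_ext _ _ (fun x => (foldl (g x) (0, d) (l x)).2)).
  move=> x; suff H s b : (foldl (g x) b s).2 =
      if i x < b.1 then b.2 else nth b.2 s (i x - b.1) by rewrite H ltn0 subn0.
  elim: s b => [|y s IHs] [c r] /=; first by rewrite nth_nil if_same.
  rewrite IHs /= ltnS; case: ltngtP => // [lt_ci | ->]; last by rewrite subnn.
  by rewrite subnS; case: (i x - c) (subn_gt0 c (i x)) => [|k //]; rewrite lt_ci.
apply: pt_snd; apply: (@pt_foldl _ _ _ g (fun=> (0, d))) => //.
- apply: pt_pair.
    exact: pt_succ (pt_fst (pt_fst (pt_snd pt_id))).
  apply: pt_if; first apply: pt_eqn.
  + exact: pt_fst (pt_fst (pt_snd pt_id)).
  + exact: pt_comp (pt_fst pt_id) Pi.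
  + exact: pt_snd (pt_snd pt_id).
  + exact: pt_snd (pt_fst (pt_snd pt_id)).
- exact: pt_cst.
apply: (@pb_foldl _ _ _ g (fun=> (0, d)) (fun _ y => (sz y).+1)).
- move=> x [c r] y; rewrite /g !sz_pair; have := sz_succ c.
  by case: ifP => _ /=; lia.
- by apply: pb_succ; apply: pt_size (pt_snd pt_id).
- exact: pb_cst.
Qed.

End Lists.

Section Cat.
Context {A Y : encType}.

Lemma pt_cat (f g : A -> seq Y) :
  ptime f -> ptime g -> ptime (fun x => f x ++ g x).
Proof.
move=> Pf Pg; apply: (@pt_ext _ _ (fun x => catrev (rev (f x)) (g x))).
  by move=> x; rewrite catrevE revK.
exact: pt_catrev (pt_rev Pf) Pg.
Qed.

End Cat.

Section Flatten.
Context {A Y : encType}.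

Lemma pt_flatten (l : A -> seq (seq Y)) :
  ptime l -> ptime (fun x => flatten (l x)).
Proof.
move=> Pl; apply: (@pt_ext _ _ (fun x => foldl cat [::] (l x))).
  move=> x; rewrite -[RHS]cat0s; elim: (l x) [::] => [|s ss IHs] t /=.
    by rewrite cats0.
  by rewrite IHs catA.
apply: pt_foldl => //.
- by apply: pt_cat; [apply: pt_fst (pt_snd pt_id) | apply: pt_snd (pt_snd pt_id)].
- exact: pt_cst.
apply: (@pb_foldl _ _ _ (fun _ => cat) (fun=> [::]) (fun _ y => sz y)).
- by move=> _ s t; apply: sz_cat.
- exact: pt_size (pt_snd pt_id).
- exact: pb_cst.
Qed.

Lemma pt_filter (p : A -> Y -> bool) (l : A -> seq Y) :
  ptime (fun z : A * Y => p z.1 z.2) -> ptime l ->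
  ptime (fun x => [seq y <- l x | p x y]).
Proof.
move=> Pp Pl.
apply: (@pt_ext _ _ (fun x => flatten [seq (if p x y then [:: y] else [::]) | y <- l x])).
  by move=> x; elim: (l x) => //= y s ->; case: (p x y).
apply: pt_flatten; apply: (pt_map (f := fun x y => if p x y then [:: y] else [::])) => //.
apply: pt_if => //; last exact: pt_cst.
by apply: pt_cons; [apply: pt_snd pt_id | apply: pt_cst].
Qed.

(** The range is that of the length of a list: [iota 0 n] for a number [n] would not do, as numbers
    are written in binary and its length is exponential in their size. *)
Lemma pt_indices (l : A -> seq Y) :
  ptime l -> ptime (fun x => iota 0 (size (l x))).
Proof.
move=> Pl; pose g (x : A) (b : nat * seq nat) (y : Y) := (b.1.+1, b.1 :: b.2).
have gE x s : foldl (g x) (0, [::]) s = (size s, rev (iota 0 (size s))).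
  suff H c t : foldl (g x) (c, t) s = (c + size s, catrev (iota c (size s)) t).
    exact: H.
  elim: s c t => [|y s IHs] c t /=; first by rewrite addn0.
  by rewrite IHs addSnnS.
apply: (@pt_ext _ _ (fun x => rev (foldl (g x) (0, [::]) (l x)).2)).
  by move=> x; rewrite gE revK.
apply: pt_rev; apply: pt_snd; apply: (@pt_foldl _ _ _ g (fun=> (0, [::]))) => //.
- have P1 : ptime (fun z : A * (nat * seq nat * Y) => z.2.1.1).
    exact: pt_fst (pt_fst (pt_snd pt_id)).
  apply: pt_pair (pt_succ P1) (pt_cons P1 _).
  exact: pt_snd (pt_fst (pt_snd pt_id)).
- exact: pt_cst.
apply: (@pb_le _ _ (fun z => sz z + (sz z * (sz z + 1) + 2))); last by pb.
move=> [x s]; rewrite gE sz_pair /=.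
have le_s : size s < sz (x, s) by rewrite sz_pair; have := size_le_sz s; lia.
have le1 : sz (size s) <= sz (x, s) by apply: leq_trans (sz_le _) le_s.
suff le2 t : all (fun i => i < size s) t ->
    sz t <= size t * (sz (x, s) + 1) + 1.
  apply: leq_trans (leq_add le1 (leqnn _)) _; rewrite ltn_add2l.
  apply: leq_ltn_trans (le2 _ _) _.
    by rewrite all_rev; apply/allP => i; rewrite mem_iota.
  by rewrite size_rev size_iota addn2 addn1 ltnS ltnS leq_mul // ltnW.
elim: t => //= i t IHt /andP[lt_i /IHt le_t]; rewrite sz_cons mulSn.
rewrite -addSn -addnA leq_add // addn1 ltnS.
exact: leq_trans (sz_mono (ltnW lt_i)) le1.
Qed.

End Flatten.

Ltac pt_step := lazymatch goal with
  | |- ptime (fun x => x) => exact: pt_id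
  | |- ptime fst => exact: (pt_fst pt_id)
  | |- ptime snd => exact: (pt_snd pt_id)
  | |- ptime (fun x => fst (@?f x)) => apply: (pt_fst (f := f))
  | |- ptime (fun x => snd (@?f x)) => apply: (pt_snd (f := f))
  | |- ptime (fun x => (@?f x, @?g x)) => apply: (pt_pair (f := f) (g := g))
  | |- ptime (fun x => cons (@?f x) (@?g x)) => apply: (pt_cons (f := f) (g := g))
  | |- ptime (fun x => Some (@?f x)) => apply: (pt_some (f := f))
  | |- ptime (fun x => S (@?f x)) => apply: (pt_succ (f := f))
  | |- ptime (fun x => addn (@?f x) (@?g x)) => apply: (pt_add (f := f) (g := g))
  | |- ptime (fun x => muln (@?f x) (@?g x)) => apply: (pt_mul (f := f) (g := g))
  | |- ptime (fun x => minn (@?f x) (@?g x)) => apply: (pt_minn (f := f) (g := g))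
  | |- ptime (fun x => leq (@?f x) (@?g x)) => apply: (pt_leq (f := f) (g := g))
  | |- ptime (fun x => @eq_op _ (@?f x) (@?g x)) => apply: (pt_eqn (f := f) (g := g))
  | |- ptime (fun x => negb (@?f x)) => apply: (pt_neg (b := f))
  | |- ptime (fun x => andb (@?f x) (@?g x)) => apply: (pt_and (b := f) (c := g))
  | |- ptime (fun x => cat (@?f x) (@?g x)) => apply: (pt_cat (f := f) (g := g))
  | |- ptime (fun x => flatten (@?f x)) => apply: (pt_flatten (l := f))
  | |- ptime (fun x => rev (@?f x)) => apply: (pt_rev (f := f))
  | |- ptime (fun x => iota 0 (size (@?f x))) => apply: (pt_indices (l := f))
  | |- ptime (fun x => nth ?d (@?f x) (@?g x)) => apply: (pt_nth d (l := f) (i := g))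
  | |- ptime (fun x => map (@?f x) (@?g x)) => apply: (pt_map (f := f) (l := g))
  | |- ptime (fun x => filter (@?f x) (@?g x)) => apply: (pt_filter (p := f) (l := g))
  | |- ptime (fun x => all (@?f x) (@?g x)) => apply: (pt_all (f := f) (l := g))
  | |- ptime (fun x => ?c) => exact: pt_cst
  end; cbv beta.

Ltac pt := repeat first [assumption | pt_step | apply: pt_if].

Section Consecutive.
Context {A Y : encType}.

Lemma pt_consecutive (f : A -> seq Y) :
  ptime f -> ptime (fun x => zip (f x) (behead (f x))).
Proof.
(* The state holds the previous entry, absent at the start, and the pairs in reverse order. *)
move=> Pf; pose g (_ : A) (b : option Y * seq (Y * Y)) v :=
  (Some v, if b.1 is Some u then (u, v) :: b.2 else b.2).
apply: (@pt_ext _ _ (fun x => rev (foldl (g x) (None, [::]) (f x)).2)).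
  move=> x; case: (f x) => //= u s.
  suff H t : (foldl (g x) (Some u, t) s).2 = catrev (zip (u :: s) s) t.
    by rewrite H revK.
  by elim: s u t => //= v s IHs u t; rewrite IHs.
apply: pt_rev; apply: pt_snd; apply: (@pt_foldl _ _ _ g (fun=> (None, [::]))) => //.
- apply: pt_pair; first by pt.
  apply: (pt_ocase (o := fun z : A * (option Y * seq (Y * Y) * Y) => z.2.1.1)
    (f := fun z u => (u, z.2.2) :: z.2.1.2) (g := fun z => z.2.1.2)); pt.
- exact: pt_cst.
apply: (@pb_foldl _ _ _ g (fun=> (None, [::])) (fun _ v => 2 * sz v + 9)).
- by move=> x [[u|] s] v; rewrite /g /= !sz_pair ?sz_cons ?sz_pair !sz_some; lia.
- apply: pb_add; last exact: pb_cst.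
  by apply: pb_mul (pb_cst 2) _; apply: pt_size (pt_snd pt_id).
- exact: pb_cst.
Qed.

End Consecutive.

(* Fractions are not reduced; adding a fraction multiplies the sum of the numerator and
   the denominator by at most its own, hence [sz_qadd]. *)
Definition qadd (p q : nat * nat) := (p.1 * q.2 + q.1 * p.2, p.2 * q.2).

Lemma sz_qadd b s k : b.1 + b.2 < 2 ^ k ->
  (foldl qadd b s).1 + (foldl qadd b s).2 < 2 ^ (k + sz s).
Proof.
elim: s b k => [|q s IHs] b k lt_b /=.
  by apply: leq_trans lt_b _; rewrite leq_exp2l ?leq_addr.
rewrite sz_cons; have -> : k + (sz q + sz s).+1 = k + (sz q).+1 + sz s by lia.
apply: IHs; rewrite /qadd /=.
have lt_q : q.1 + q.2 < 2 ^ (sz q).+1.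
  apply: leq_trans (ltn_sz _) _; rewrite leq_exp2l //.
  by apply: leq_trans (sz_add _ _) _; case: q => q1 q2; rewrite sz_pair /=; lia.
apply: (@leq_ltn_trans ((b.1 + b.2) * (q.1 + q.2))); first by nia.
by rewrite expnD ltn_mul.
Qed.

Lemma pt_qsum (A : encType) (f : A -> seq (nat * nat)) :
  ptime f -> ptime (fun x => foldl qadd (0, 1) (f x)).
Proof.
move=> Pf; apply: (@pt_foldl _ _ _ (fun=> qadd) (fun=> (0, 1))) => //.
- by rewrite /qadd; pt.
- exact: pt_cst.
apply: (@pb_le _ _ (fun z => 3 * sz z + 3)); last by pb.
move=> [x s] /=; have := @sz_qadd (0, 1) s 1 isT.
move: (foldl _ _ _) => [p q] /= lt_pq; rewrite !sz_pair.
have le_p : sz p <= 1 + sz s.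
  by apply: leq_sz => //; apply: leq_ltn_trans lt_pq; apply: leq_addr.
have le_q : sz q <= 1 + sz s.
  by apply: leq_sz => //; apply: leq_ltn_trans lt_pq; apply: leq_addl.
by have := sz_gt0 x; lia.
Qed.

Definition keep_best T (lt : rel T) (b : option T) (y : T) :=
  if b is Some z then (if lt y z then Some y else Some z) else Some y.

Lemma pt_best (A Y : encType) (lt : rel Y) (l : A -> seq Y) :
  ptime (fun z : Y * Y => lt z.1 z.2) -> ptime l ->
  ptime (fun x => foldl (keep_best lt) None (l x)).
Proof.
move=> Plt Pl; apply: (@pt_foldl _ _ _ (fun=> keep_best lt) (fun=> None)) => //.
- apply: (pt_ocase (o := fun z : A * (option Y * Y) => z.2.1)
    (g := fun z => Some z.2.2) (f := fun z w => if lt z.2.2 w then Some z.2.2 else Some w)).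
  + by pt.
  + apply: pt_if; [|by pt|by pt].
    exact: (pt_app2 (f := lt) (g := fun z : A * (option Y * Y) * Y => z.1.2.2)
      Plt (pt_snd (pt_snd (pt_fst pt_id))) (pt_snd pt_id)).
  + by pt.
- exact: pt_cst.
apply: (@pb_le _ _ (fun z => sz z + 2)); last by pb.
(* The accumulator is always the initial one or an entry of the list, so a maximum bounds it rather
   than a sum. *)
move=> [x s] /=; suff H b : sz (foldl (keep_best lt) b s) <= maxn (sz b) (sz s + 2).
  by apply: leq_trans (H None) _; rewrite sz_pair (_ : sz None = 1) //; lia.
elim: s b => [|y s IHs] b /=; first by rewrite leq_maxl.
apply: leq_trans (IHs _) _; rewrite sz_cons.
suff: sz (keep_best lt b y) <= maxn (sz b) (sz y).+2 by lia.
by case: b => [z|] /=; [case: ifP => _|]; rewrite ?sz_some; lia.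
Qed.

Fixpoint tuples T (m : nat) (V : seq T) : seq (seq T) :=
  if m is m'.+1 then
    flatten [seq [seq v :: x | x <- tuples m' V] | v <- V]
  else [:: [::]].

(** [m] is a constant of the program: the induction builds a program of [m] nested loops, whose
    degree grows with [m]. *)
Lemma pt_tuples (A Y : encType) m (V : A -> seq Y) :
  ptime V -> ptime (fun x => tuples m (V x)).
Proof.
move=> PV; elim: m => [|m IHm] /=; first by pt.
apply: pt_flatten; apply: (pt_map (f := fun x v => [seq v :: y | y <- tuples m (V x)])) => //.
apply: (pt_map (f := fun (z : A * Y) y => z.2 :: y)); first by pt.
exact: pt_comp (pt_fst pt_id) IHm.
Qed.

Lemma mem_tuples (T : eqType) m (V x : seq T) :
  (x \in tuples m V) = (size x == m) && all (mem V) x.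
Proof.
elim: m x => [|m IHm] [|v x] //=.
  by apply/negP => /flattenP[s /mapP[v _ ->] /mapP[y _]].
rewrite eqSS andbCA -IHm; apply/flattenP/andP => [[s]|[Vv Hx]].
  by move=> /mapP[w Vw ->] /mapP[y Hy [-> ->]].
by exists [seq v :: y | y <- tuples m V]; apply: map_f.
Qed.

(** * The reduction as a program *)

Definition raw_graph := seq (seq (option ((nat * nat) * nat))).
Definition raw_tree := ((nat * nat) * seq (nat * nat))%type.

Definition lookup (M : raw_graph) (a b : nat) := nth None (nth [::] M a) b.

Definition raw_length (M : raw_graph) (a : nat * nat) : nat * nat :=
  if lookup M a.1 a.2 is Some e then e.1 else (0, 1).

Section Queries.
Variables (K m : nat) (pars : seq nat) (labs : seq (nat * seq nat)).
Variables (sigma : seq (nat * nat)).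

Definition index_pairs := [seq ij <- [seq (i, j) | i <- iota 0 m.+1, j <- iota 0 m.+1]
                               | ij.1 < ij.2].

(** Decides [placed]. Position 0 of [keys] is the root and position [i.+1] is key [i], so the first
    test also keeps the keys away from the root. *)
Definition raw_placed (T keys : seq nat) : bool :=
  all (fun ij => nth 0 keys ij.1 != nth 0 keys ij.2) index_pairs &&
  all (fun jt => nth 0 T jt.1 == nth 0 keys jt.2) sigma.

(* [keys] starts with the root.  A key vertex gets the origin [n], which is out of
   range, so that [lookup] finds no edge at it. *)
Definition raw_origins (n : nat) (M : raw_graph) (keys : seq nat) : seq nat :=
  [seq if all (fun k => u != k) keys then u else n | u <- iota 0 (size M)] ++
  ([seq nth 0 keys p | p <- pars] ++ behead keys).

Definition relabel (e : option ((nat * nat) * nat)) :=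
  if e is Some e' then Some (e'.1, minn e'.2 K) else None.

(** Vertices are numbered with the [n] original ones first, then the [m] source copies, then the [m]
    sink copies. The [K.+1] labels are the truncated capacities 0 to [K]. *)
Definition raw_query (n : nat) (M : raw_graph) (os : seq nat) :=
  (n + (m + m),
    (K.+1,
      ([seq [seq relabel (lookup M a b) | b <- os] | a <- os],
       [seq ((n + c.1, n + (m + c.1)), c.2) | c <- labs]))).

(** The origins travel with their query because they translate the paths of the answer back to the
    original graph. *)
Definition raw_candidates (n : nat) (M : raw_graph) (T : seq nat) (r : nat) :=
  [seq (raw_origins n M (r :: x), raw_query n M (raw_origins n M (r :: x)))
     | x <- [seq x <- tuples m (iota 0 (size M)) | raw_placed T (r :: x)]].

End Queries.

Section PtimeQueries.
Context {A : encType}.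
Variables (K m : nat) (pars : seq nat) (labs : seq (nat * seq nat)).
Variables (sigma : seq (nat * nat)).
Variables (n : A -> nat) (M : A -> raw_graph) (T : A -> seq nat) (r : A -> nat).
Hypotheses (Pn : ptime n) (PM : ptime M) (PT : ptime T) (Pr : ptime r).

Lemma pt_candidates :
  ptime (fun x => raw_candidates K m pars labs sigma (n x) (M x) (T x) (r x)).
Proof.
have P1 (B C : encType) (f : A -> B) : ptime f -> ptime (fun z : A * C => f z.1).
  by move=> Pf; apply: pt_comp Pf; apply: pt_fst pt_id.
have P2 (C D B : encType) (f : A -> B) :
    ptime f -> ptime (fun z : A * C * D => f z.1.1).
  by move=> Pf; apply: pt_comp Pf; apply: pt_fst (pt_fst pt_id).
have P3 (C D E B : encType) (f : A -> B) :
    ptime f -> ptime (fun z : A * C * D * E => f z.1.1.1).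
  by move=> Pf; apply: pt_comp Pf; apply: pt_fst (pt_fst (pt_fst pt_id)).
have Pos : ptime (fun z : A * seq nat =>
    raw_origins pars (n z.1) (M z.1) (r z.1 :: z.2)).
  by rewrite /raw_origins /=; pt; first [exact: P1 | exact: P2].
rewrite /raw_candidates.
apply: (pt_map (f := fun x y => (raw_origins pars (n x) (M x) (r x :: y),
  raw_query K m labs (n x) (M x) (raw_origins pars (n x) (M x) (r x :: y))))).
  apply: pt_pair => //; rewrite /raw_query.
  apply: pt_pair; first by pt; exact: P1.
  apply: pt_pair; first by pt.
  apply: pt_pair; last by pt; exact: P2.
  apply: (pt_map (f := fun z a => [seq relabel K (lookup (M z.1) a b)
     | b <- raw_origins pars (n z.1) (M z.1) (r z.1 :: z.2)])) => //.
  apply: (pt_map (f := fun z b => relabel K (lookup (M z.1.1) z.2 b))); last first.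
    exact: pt_comp (pt_fst pt_id) Pos.
  rewrite /relabel.
  apply: (pt_ocase (o := fun z : A * seq nat * nat * nat => lookup (M z.1.1.1) z.1.2 z.2)
     (f := fun z e' => Some (e'.1, minn e'.2 K)) (g := fun=> None)).
  - by rewrite /lookup; pt; exact: P3.
  - by pt.
  - by pt.
apply: (pt_filter (p := fun x y => raw_placed m sigma (T x) (r x :: y))).
  by rewrite /raw_placed; pt; exact: P2.
apply: pt_tuples; pt.
Qed.

End PtimeQueries.

Definition raw_result (M : raw_graph) (os : seq nat) (ps : seq (seq nat)) : raw_tree :=
  let arcs := flatten [seq zip [seq nth 0 os v | v <- mu]
                              (behead [seq nth 0 os v | v <- mu]) | mu <- ps] in
  (foldl qadd (0, 1) [seq raw_length M a | a <- arcs], arcs).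

Definition raw_results (M : raw_graph)
    (l : seq (seq nat * option (seq (seq nat)))) : seq raw_tree :=
  flatten [seq if c.2 is Some ps then [:: raw_result M c.1 ps] else [::] | c <- l].

(** Strict comparison of fractions by cross-multiplication, meaningful for positive denominators. *)
Definition raw_shorter : rel raw_tree :=
  fun s t => ~~ (t.1.1 * s.1.2 <= s.1.1 * t.1.2).

Definition raw_select (z : raw_graph * seq (seq nat * option (seq (seq nat)))) :=
  if foldl (keep_best raw_shorter) None (raw_results z.1 z.2) is Some t
  then Some t.2 else None.

Lemma pt_select : ptime raw_select.
Proof.
rewrite /raw_select.
apply: (pt_ocase (o := fun z : raw_graph * seq (seq nat * option (seq (seq nat))) =>
   foldl (keep_best raw_shorter) None (raw_results z.1 z.2))
  (f := fun _ t => Some t.2) (g := fun=> None)); [|by pt|by pt].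
apply: pt_best; first by rewrite /raw_shorter; pt.
rewrite /raw_results; apply: pt_flatten.
apply: (pt_map (f := fun z c => if c.2 is Some ps
   then [:: raw_result z.1 c.1 ps] else [::])); last by pt.
apply: (pt_ocase (o := fun z : raw_graph * seq (seq nat * option (seq (seq nat))) *
     (seq nat * option (seq (seq nat))) => z.2.2)
  (f := fun z ps => [:: raw_result z.1.1 z.2.1 ps]) (g := fun=> [::])); [by pt| |by pt].
apply: pt_cons; last by pt.
rewrite /raw_result.
set B := prod_encType _ _.
have Parcs : ptime (fun z : B => flatten [seq zip [seq nth 0 z.1.2.1 v | v <- mu]
                              (behead [seq nth 0 z.1.2.1 v | v <- mu]) | mu <- z.2]).
  apply: pt_flatten.
  apply: (pt_map (f := fun (z : B) mu => zip [seq nth 0 z.1.2.1 v | v <- mu]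
                              (behead [seq nth 0 z.1.2.1 v | v <- mu]))); last by pt.
  by apply: pt_consecutive; pt.
apply: pt_pair => //; apply: pt_qsum.
apply: (pt_map (f := fun (z : B) a => raw_length z.1.1.1 a)) => //.
rewrite /raw_length.
apply: (pt_ocase (o := fun z : B * (nat * nat) => lookup z.1.1.1.1 z.2.1 z.2.2)
   (f := fun _ e => e.1) (g := fun=> (0, 1))); [|by pt|by pt].
by rewrite /lookup; pt.
Qed.

(** * Skeletons of trees and disjoint paths *)

Lemma uniq_flatten_map (I T : eqType) (f : I -> seq T) (l : seq I) :
  uniq l -> (forall i, uniq (f i)) ->
  (forall i j a, a \in f i -> a \in f j -> i = j) ->
  uniq (flatten [seq f i | i <- l]).
Proof.
move=> Ul Uf disj; elim: l Ul => //= i l IHl /andP[il /IHl Ul].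
rewrite cat_uniq Uf Ul andbT; apply/hasPn => a /flattenP[_ /mapP[j jl ->] aj].
by apply: contra il => /disj/(_ aj) ->.
Qed.

Lemma uniq_map_inj (T1 T2 : eqType) (f : T1 -> T2) s :
  uniq (map f s) -> {in s &, injective f}.
Proof.
elim: s => //= x s IHs /andP[fx /IHs inj] y z; rewrite !inE.
move=> /predU1P[->|ys] /predU1P[->|zs] // Ef; last exact: inj.
  by rewrite Ef map_f in fx.
by rewrite -Ef map_f in fx.
Qed.

Lemma zip_behead_map A B (f : A -> B) s :
  zip (map f s) (behead (map f s)) = [seq (f a.1, f a.2) | a <- zip s (behead s)].
Proof.
case: s => // x s; elim: s x => //= y s IHs x; congr cons; exact: IHs.
Qed.

Section PathArcs.
Variable n : nat.
Implicit Types (x y : 'I_n) (p : seq 'I_n) (e : rel 'I_n).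

Lemma path_all_arcs e x p :
  path e x p = all (fun a => e a.1 a.2) (path_arcs (x :: p)).
Proof. by elim: p x => //= y p IHp x; rewrite IHp. Qed.

Lemma heads_path_arcs x p : [seq a.2 | a <- path_arcs (x :: p)] = p.
Proof. by rewrite /path_arcs /= -/(unzip2 _) unzip2_zip //= leqnSn. Qed.

Lemma mem_path_arcs x p a :
  a \in path_arcs (x :: p) -> (a.1 \in x :: p) /\ (a.2 \in p).
Proof.
elim: p x => //= y p IHp x; rewrite in_cons => /predU1P[-> | /IHp[a1 a2]] /=.
  by rewrite !mem_head.
by split; rewrite in_cons ?a1 ?a2 orbT.
Qed.

Lemma mem_head_arc x p v :
  v \in p -> exists2 u, u \in x :: p & (u, v) \in path_arcs (x :: p).
Proof.
rewrite -{1}(heads_path_arcs x p) => /mapP[[u w] a_in /= ->].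
by exists u => //; case: (mem_path_arcs a_in).
Qed.

Lemma path_arcs_map m (f : 'I_n -> 'I_m) p :
  path_arcs (map f p) = [seq (f a.1, f a.2) | a <- path_arcs p].
Proof. exact: zip_behead_map. Qed.

End PathArcs.

(* Each of the [m] key vertices has its set of terminals and its parent ([None] for
   the root); the last component locates the terminals among the key vertices. *)
Definition tree_shape (K m : nat) : finType :=
  ({ffun 'I_m -> {set 'I_K}} * {ffun 'I_m -> option 'I_m} * {ffun 'I_K -> 'I_m})%type.

Definition shape_set K m (s : tree_shape K m) := s.1.1.
Definition shape_parent K m (s : tree_shape K m) := s.1.2.
Definition shape_pos K m (s : tree_shape K m) := s.2.

(* Since the sets of terminals increase strictly, every chain of parents reaches
   the root. *)
Definition shape_ok K m (s : tree_shape K m) : bool :=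
  [forall i, if shape_parent s i is Some j
             then shape_set s i \proper shape_set s j else true] &&
  [forall j, j \in shape_set s (shape_pos s j)].

(** * The instance of disjoint paths attached to a guess *)

Section Expansion.
Variables (I : steiner_instance) (K m : nat) (s : tree_shape K m).
Variable x : {ffun 'I_m -> 'I_(st_n I)}.
Local Notation G := (st_graph I).
Local Notation r := (st_root I).
Local Notation T := (st_terminals I).
Local Notation N := (st_n I + (m + m)).

Definition terminal (j : 'I_K) : 'I_(st_n I) := nth r (enum T) j.

Definition placed : Prop :=
  [/\ injective x, forall i, x i != r & forall j, x (shape_pos s j) = terminal j].

Definition tail_key (i : 'I_m) : 'I_(st_n I) :=
  if shape_parent s i is Some j then x j else r.

Definition is_key (u : 'I_(st_n I)) : bool := (u == r) || [exists i, x i == u].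

Definition vertex_copy (u : 'I_(st_n I)) : 'I_N := lshift (m + m) u.
(** Path [i] leads from a copy of the parent of key [i] to a copy of key [i]. A key thus has one
    sink copy and as many source copies as children; the root has source copies only. *)
Definition source_copy (i : 'I_m) : 'I_N := rshift (st_n I) (lshift m i).
Definition sink_copy (i : 'I_m) : 'I_N := rshift (st_n I) (rshift m i).

(* [None] marks the original key vertices, which become isolated. *)
Definition origin (a : 'I_N) : option 'I_(st_n I) :=
  match split a with
  | inl u => if is_key u then None else Some u
  | inr b => match split b with
             | inl i => Some (tail_key i)
             | inr i => Some (x i)
             end
  end.

Definition label_edge (e : option (rat * nat)) : option (rat * 'I_K.+1) :=
  if e is Some e' then Some (e'.1, inord (minn e'.2 K)) else None.

Definition expand_graph : 'M[option (rat * 'I_K.+1)]_N :=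
  \matrix_(a, b)
    (if (origin a, origin b) is (Some u, Some v) then label_edge (G u v) else None).

Definition demand (i : 'I_m) : {set 'I_K.+1} := [set l : 'I_K.+1 | #|shape_set s i| <= l].

Definition expand : vdisj_instance :=
  @VdisjInstance N K.+1 expand_graph m (finfun source_copy) (finfun sink_copy)
    (finfun demand).

Lemma originV u : origin (vertex_copy u) = if is_key u then None else Some u.
Proof. by rewrite /origin (unsplitK (inl u)). Qed.

Lemma originS i : origin (source_copy i) = Some (tail_key i).
Proof. by rewrite /origin (unsplitK (inr (lshift m i))) (unsplitK (inl i)). Qed.

Lemma originT i : origin (sink_copy i) = Some (x i).
Proof. by rewrite /origin (unsplitK (inr (rshift m i))) (unsplitK (inr i)). Qed.

Variant copy_spec : 'I_N -> Type :=
| CopyV u : copy_spec (vertex_copy u)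
| CopyS i : copy_spec (source_copy i)
| CopyT i : copy_spec (sink_copy i).

Lemma copyP a : copy_spec a.
Proof.
rewrite -[a]splitK; case: (split a) => [u|b]; first exact: CopyV.
by rewrite -[b]splitK; case: (split b) => i; [apply: CopyS | apply: CopyT].
Qed.

Lemma source_copy_inj : injective source_copy.
Proof. by move=> i j /rshift_inj/lshift_inj. Qed.

Lemma sink_copy_inj : injective sink_copy.
Proof. by move=> i j /rshift_inj/rshift_inj. Qed.

Lemma source_neq_sink i j : source_copy i != sink_copy j.
Proof. by rewrite eq_rshift eq_lrshift. Qed.

Lemma vertex_neq_sink u j : vertex_copy u != sink_copy j.
Proof. by rewrite eq_lrshift. Qed.

Lemma vertex_neq_source u j : vertex_copy u != source_copy j.
Proof. by rewrite eq_lrshift. Qed.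

(** The default value is harmless: every vertex on a feasible path has an origin
    ([origin_collapse]). *)
Definition collapse (a : 'I_N) : 'I_(st_n I) := odflt r (origin a).

Lemma adj_expand a b :
  adj expand_graph a b ->
  [/\ origin a = Some (collapse a), origin b = Some (collapse b),
      adj G (collapse a) (collapse b) &
      expand_graph a b = label_edge (G (collapse a) (collapse b))].
Proof.
rewrite /adj mxE /collapse; case: (origin a) => // u; case: (origin b) => // v.
by rewrite /= /label_edge; case: (G u v).
Qed.

Lemma adj_expandI a b u v :
  origin a = Some u -> origin b = Some v -> adj G u v -> adj expand_graph a b.
Proof. by move=> oa ob; rewrite /adj mxE oa ob /label_edge; case: (G u v). Qed.

Lemma len_expand a b :
  adj expand_graph a b ->
  len expand_graph (a, b) = len G (collapse a, collapse b).
Proof.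
move=> /adj_expand[_ _ _ E]; rewrite /len /= E /label_edge.
by case: (G _ _).
Qed.

Lemma expand_valid directed q :
  steiner_valid directed K I -> m <= q -> vdisj_valid directed q expand.
Proof.
move=> [[irrG symG] _ _ _ [posG _]] le_mq; split=> //=.
- split=> [a|dirF a b].
    by apply/negP => /adj_expand[_ _ + _]; apply/negP/irrG.
  rewrite !mxE; case: (origin a) (origin b) => [u|] [v|] //=.
  by rewrite symG.
- move=> [a b]; case adj_ab: (adj expand_graph a b).
    by rewrite len_expand.
  by move: adj_ab; rewrite /adj /len /=; case: (expand_graph a b).
split=> [i j|i j|i j]; rewrite !ffunE; first exact: source_copy_inj.
  exact: sink_copy_inj.
exact: source_neq_sink.
Qed.

(** * From disjoint paths to a feasible tree *)

Section Collapse.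
Hypotheses (s_ok : shape_ok s) (x_ok : placed).
Hypothesis T_card : #|T| = K.
Variable mu : {ffun 'I_m -> seq 'I_N}.
Hypothesis mu_ok : vdisj_feasible expand mu.

Let p i := behead (mu i).

Let mu_links i :
  [/\ mu i = source_copy i :: p i, last (source_copy i) (p i) = sink_copy i,
      path (adj expand_graph) (source_copy i) (p i) & uniq (source_copy i :: p i)].
Proof.
have [/(_ i) + _ _] := mu_ok; rewrite /p /links; case: (mu i) => //= y q.
by rewrite !ffunE => /and4P[/eqP-> /eqP-> -> ->].
Qed.

Let sink_in i : sink_copy i \in p i.
Proof.
have [_ + _ _] := mu_links i; case/lastP: (p i) => [/eqP|q y /=].
  by rewrite (negPf (source_neq_sink _ _)).
by rewrite last_rcons => ->; rewrite mem_rcons mem_head.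
Qed.

Let p_disjoint i j a : a \in mu i -> a \in mu j -> i = j.
Proof.
move=> ai aj; apply/eqP; apply: contraLR (isT) => neq_ij.
have [_ _ /(_ _ _ neq_ij)] := mu_ok.
by rewrite disjoint_has => /hasPn/(_ _ ai); rewrite aj.
Qed.

Let sub_p i a : a \in p i -> a \in mu i.
Proof. exact: mem_behead. Qed.

Let arc_adj i a : a \in path_arcs (mu i) -> adj expand_graph a.1 a.2.
Proof.
have [-> _ + _] := mu_links i; rewrite path_all_arcs => /allP; exact.
Qed.

(** After its start a path meets no source copy: that of [j] lies on [mu j], so disjointness forces
    [j = i], and a simple path does not return to its first vertex. *)
Let head_origin i b : b \in p i ->
  origin b = Some (collapse b) /\
  (b = vertex_copy (collapse b) /\ ~~ is_key (collapse b) \/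
   exists2 j, b = sink_copy j & collapse b = x j).
Proof.
move=> b_in; have ob : origin b = Some (collapse b).
  have [Emu _ _ _] := mu_links i.
  have [a _ ab] := mem_head_arc (source_copy i) b_in.
  by have := arc_adj (i := i); rewrite Emu => /(_ _ ab)/adj_expand[].
split=> //; move: ob b_in; rewrite /collapse; case: (copyP b) => [u|j|j].
- by rewrite originV; case: ifP => // /negbT ku _ _; left.
- move=> _ b_in; have [Emu _ _] := mu_links i.
  have /p_disjoint := sub_p b_in => /(_ j); have [-> _ _ _] := mu_links j.
  by move=> /(_ (mem_head _ _)) def_j; rewrite -def_j in b_in; rewrite /= b_in.
- by rewrite originT => _ _; right; exists j.
Qed.

Let key_x j : is_key (x j).
Proof. by apply/orP; right; apply/existsP; exists j. Qed.

Let head_neq_root i b : b \in p i -> collapse b != r.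
Proof.
have [_ x_r _] := x_ok => /head_origin[_ [[_]|[j _ ->//]]].
by apply: contra => /eqP->; rewrite /is_key eqxx.
Qed.

(** A vertex that is not a key has one usable copy and a key has one sink copy. Source copies, where
    injectivity fails, are not heads of arcs. *)
Let collapse_inj i j a b :
  a \in p i -> b \in p j -> collapse a = collapse b -> a = b.
Proof.
have [x_inj _ _] := x_ok => /head_origin[_ Ha] /head_origin[_ Hb] Eab.
case: Ha Hb => [[Ea na]|[i' Ea xa]] [[Eb nb]|[j' Eb xb]].
- by rewrite Ea Eb Eab.
- by move: na; rewrite Eab xb key_x.
- by move: nb; rewrite -Eab xa key_x.
- by rewrite Ea Eb; congr sink_copy; apply: x_inj; rewrite -xa -xb.
Qed.

Let collapse_inj_index i j a b :
  a \in p i -> b \in p j -> collapse a = collapse b -> i = j.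
Proof.
move=> ai bj /(collapse_inj ai bj) Eab; rewrite -Eab in bj.
exact: p_disjoint (sub_p ai) (sub_p bj).
Qed.

Let collapse_source i : collapse (source_copy i) = tail_key i.
Proof. by rewrite /collapse originS. Qed.

Let collapse_sink i : collapse (sink_copy i) = x i.
Proof. by rewrite /collapse originT. Qed.

Definition tree_arcs : seq ('I_(st_n I) * 'I_(st_n I)) :=
  flatten [seq path_arcs (map collapse (mu i)) | i <- enum 'I_m].

Let S := [set a in tree_arcs].

Let tree_arcsP u v : reflect
  (exists i a b, [/\ (a, b) \in path_arcs (mu i), u = collapse a & v = collapse b])
  ((u, v) \in tree_arcs).
Proof.
apply: (iffP flattenP) => [[q /mapP[i _ ->]]|[i [a [b [ab -> ->]]]]].
  by rewrite path_arcs_map => /mapP[[a b] ab [-> ->]]; exists i, a, b.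
exists (path_arcs (map collapse (mu i))); first by apply: map_f; rewrite mem_enum.
by rewrite path_arcs_map; apply/mapP; exists (a, b).
Qed.

Let arc_ends i a b : (a, b) \in path_arcs (mu i) ->
  (a = source_copy i \/ a \in p i) /\ b \in p i.
Proof.
have [-> _ _ _] := mu_links i => /mem_path_arcs[] /=.
by rewrite in_cons => /predU1P.
Qed.

(** This gives both the unique parents in the tree and the absence of repeated arcs, so that no
    length is counted twice. *)
Let heads_uniq : uniq [seq a.2 | a <- tree_arcs].
Proof.
rewrite /tree_arcs map_flatten -map_comp.
have Eh i : [seq a.2 | a <- path_arcs (map collapse (mu i))] = map collapse (p i).
  by have [-> _ _ _] := mu_links i; rewrite heads_path_arcs.
apply: uniq_flatten_map => [|i|i j v] /=; first exact: enum_uniq.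
  have [_ _ _ /andP[_ Up]] := mu_links i.
  by rewrite Eh map_inj_in_uniq // => a b; apply: collapse_inj.
rewrite !Eh => /mapP[a ai ->] /mapP[b bj]; exact: collapse_inj_index.
Qed.

Lemma tree_arcs_uniq : uniq tree_arcs.
Proof. exact: map_uniq heads_uniq. Qed.

(** Induction up the skeleton: passing to the parent strictly enlarges the set of terminals, whose
    size is at most [K]. *)
Let root_reaches i a : a \in mu i -> connect (arc_rel S) r (collapse a).
Proof.
have [k] := ubnP (K - #|shape_set s i|); elim: k i a => // k IHk i a lt_k.
have [Emu lst _ _] := mu_links i.
have Hpath : path (arc_rel S) (collapse (source_copy i)) (map collapse (p i)).
  rewrite path_all_arcs -map_cons path_arcs_map -Emu; apply/allP => _ /mapP[[u v] uv ->].
  by rewrite /arc_rel inE; apply/tree_arcsP; exists i, u, v.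
rewrite Emu => a_in; apply: (@connect_trans _ _ (tail_key i)).
  rewrite /tail_key; case Epar: (shape_parent s i) => [j|]; last exact: connect0.
  rewrite -collapse_sink; apply: IHk (sub_p (sink_in j)).
  have /andP[/forallP/(_ i)] := s_ok; rewrite Epar => /proper_card lt_ij _.
  have : #|shape_set s j| <= K by rewrite -[leqRHS]card_ord max_card.
  by lia.
rewrite -collapse_source; apply: path_connect Hpath _ _.
by rewrite -map_cons map_f.
Qed.

Let tree_out : out_tree S r.
Proof.
split=> [u|u u' v|v].
- rewrite inE; apply/tree_arcsP => -[i [a [b [ab _ Er]]]].
  by have [_ /head_neq_root] := arc_ends ab; rewrite -Er eqxx.
- rewrite !inE => uv u'v; suff: (u, v) = (u', v) by case.
  have: {in tree_arcs &, injective (fun a => a.2 : 'I_(st_n I))}.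
    exact: uniq_map_inj.
  exact.
- rewrite !inE => /predU1P[->|/orP[]/imsetP[[u w]]]; first exact: connect0.
    rewrite inE => /tree_arcsP[i [a [b [ab -> _]]]] ->.
    apply: (root_reaches (i := i)); have [[->|/sub_p//] _] := arc_ends ab.
    by have [-> _ _ _] := mu_links i; apply: mem_head.
  rewrite inE => /tree_arcsP[i [a [b [ab _ ->]]]] ->.
  by apply: (root_reaches (i := i)); have [_ /sub_p] := arc_ends ab.
Qed.

Let terminalP t : t \in T -> exists j, t = terminal j.
Proof.
rewrite -mem_enum => tT; have lt_t : index t (enum T) < K.
  by rewrite -T_card cardE index_mem.
by exists (Ordinal lt_t); rewrite /terminal nth_index.
Qed.

(** Walking down the tree, the guessed set can only shrink: it is constant along a path and passes
    to a child's set at a key. Hence the terminals below an arc of path [i] belong to the set of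
    [i]. *)
Let reached_sets i v w : connect (arc_rel S) v w ->
  (exists2 b, b \in p i & v = collapse b) ->
  exists j b, [/\ b \in p j, w = collapse b & shape_set s j \subset shape_set s i].
Proof.
move=> /connectP[q Hq ->] [b bi Ev]; move: Hq; rewrite {}Ev.
have : exists j c, [/\ c \in p j, collapse b = collapse c &
    shape_set s j \subset shape_set s i] by exists i, b.
elim: q {bi} (collapse b) => //= y q IHq u [j [c [cj -> sub_j]]].
move=> /andP[]; rewrite /arc_rel inE => /tree_arcsP[k [a [d [ad Eca ->]]]].
apply: IHq; exists k, d; have [a_in dk] := arc_ends ad; split=> //.
(* Either the walk stays on its path, or it starts path [k] at the parent of [k]; in the latter case
   the vertex just left is the sink of that parent, the root being no head. *)
apply: subset_trans sub_j; case: a_in => [Ea|ak]; last first.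
  by rewrite (collapse_inj_index cj ak Eca).
move: Eca; rewrite Ea collapse_source /tail_key.
case Epar: (shape_parent s k) => [l|] Ec; last first.
  by have := head_neq_root cj; rewrite Ec eqxx.
have := collapse_inj_index cj (sink_in l); rewrite collapse_sink => /(_ Ec) ->.
have /andP[/forallP/(_ k)] := s_ok; rewrite Epar => /proper_sub ? _.
by [].
Qed.

Lemma origin_collapse i a : a \in mu i -> origin a = Some (collapse a).
Proof.
have [-> _ _ _] := mu_links i; rewrite in_cons => /predU1P[->|/head_origin[]//].
by rewrite collapse_source originS.
Qed.

Lemma collapse_feasible : steiner_feasible I S.
Proof.
have [_ _ x_pos] := x_ok; split=> //.
- move=> u v; rewrite inE => /tree_arcsP[i [a [b [ab -> ->]]]].
  by have [] := adj_expand (arc_adj ab).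
- apply/subsetP => t /terminalP[j ->]; rewrite -x_pos -collapse_sink !inE.
  apply/orP; right; apply/orP; right.
  have := sink_in (shape_pos s j); set i := shape_pos s j.
  move=> /(mem_head_arc (source_copy i))[a _]; have [<- _ _ _] := mu_links i.
  move=> ab; apply/imsetP; exists (collapse a, collapse (sink_copy i)) => //.
  by rewrite inE; apply/tree_arcsP; exists i, a, (sink_copy i).
move=> u v; rewrite inE => /tree_arcsP[i [a [b [ab -> ->]]]].
have [_ bi] := arc_ends ab.
have adj_ab := arc_adj ab; have [_ _ _ E] := adj_expand adj_ab.
have [_ /(_ i)/allP/(_ _ ab)] := mu_ok.
rewrite /has_label_in /= ffunE E /capacity /= /label_edge => + _.
move: (adj_ab); rewrite /adj E /label_edge; case: (G _ _) => // e _ /=.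
rewrite inE inordK ?ltnS ?geq_minr // leq_min => /andP[le_e _].
apply: leq_trans le_e.
(* The label of the arc is at most its capacity and at least the size of the guessed set, so
   inclusion in that set is enough. *)
suff sub : [set t in T | connect (arc_rel S) (collapse b) t] \subset
    terminal @: shape_set s i.
  exact: leq_trans (subset_leq_card sub) (leq_imset_card _ _).
apply/subsetP => t; rewrite inE => /andP[/terminalP[j ->]].
move=> /reached_sets/(_ (ex_intro2 _ _ b bi erefl))[k [c [ck Ec sub_k]]].
apply: imset_f; apply: (subsetP sub_k).
move: Ec; rewrite -x_pos -collapse_sink => /(collapse_inj_index (sink_in _) ck) <-.
by have /andP[_ /forallP] := s_ok.
Qed.

Lemma collapse_length : tree_length I S = paths_length expand mu.
Proof.
rewrite /tree_length (eq_bigl (mem tree_arcs)) => [|a]; last by rewrite inE.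
rewrite -big_uniq ?tree_arcs_uniq //= big_flatten big_map big_enum /=.
apply: eq_bigr => i _; rewrite path_arcs_map big_map [LHS]big_seq [RHS]big_seq.
by apply: eq_bigr => -[a b] /arc_adj adj_ab; rewrite len_expand.
Qed.

End Collapse.

Lemma path_expand a p :
  all (fun b => origin b == Some (collapse b)) (a :: p) ->
  path (adj G) (collapse a) (map collapse p) -> path (adj expand_graph) a p.
Proof.
elim: p a => //= b p IHp a /and3P[/eqP oa ob op] /andP[ab bp].
by rewrite (adj_expandI oa (eqP ob) ab) IHp //= ob.
Qed.

End Expansion.

(** * From a feasible tree to disjoint paths *)

Section Skeleton.
Variables (I : steiner_instance) (K : nat).
Local Notation G := (st_graph I).
Local Notation r := (st_root I).
Local Notation T := (st_terminals I).
Local Notation V := 'I_(st_n I).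
Variable S : {set V * V}.
Hypotheses (S_ok : steiner_feasible I S) (T_card : #|T| = K) (rT : r \notin T).
Hypothesis len_ge0 : nonneg_lengths G.

Let R := arc_rel S.

Let no_parent u : ~~ R u r.
Proof. by have [_ [H _ _] _ _] := S_ok; apply: H. Qed.

Let unique_parent u u' v : R u v -> R u' v -> u = u'.
Proof. by have [_ [_ H _] _ _] := S_ok; apply: H. Qed.

Let reach_tail u v : R u v -> connect R r u.
Proof.
have [_ [_ _ H] _ _] := S_ok => uv; apply: H; rewrite !inE; apply/orP; right.
by apply/orP; left; apply/imsetP; exists (u, v).
Qed.

Let reach_terminal t : t \in T -> connect R r t.
Proof. by have [_ [_ _ H] /subsetP sub _] := S_ok => /sub; apply: H. Qed.

Let unique_path p q : path R r p -> path R r q -> last r p = last r q -> p = q.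
Proof.
elim/last_ind: p q => [|p v IHp] q; case/lastP: q => [|q w] //.
- rewrite rcons_path last_rcons => _ /andP[_ Rq] /= E.
  by rewrite -E (negPf (no_parent _)) in Rq.
- rewrite rcons_path last_rcons => /andP[_ Rp] _ /= E.
  by rewrite E (negPf (no_parent _)) in Rp.
rewrite !rcons_path !last_rcons => /andP[Pp Rp] /andP[Pq Rq] Evw.
by rewrite Evw in Rp *; rewrite (IHp q) // (unique_parent Rp Rq).
Qed.

(** Walks from the root to a given vertex coincide, so their length is well defined; unreachable
    vertices get 0. Depth excludes cycles and comparable siblings. *)
Let depth_ex : exists dep : V -> nat, forall u v, R u v -> dep v = (dep u).+1.
Proof.
have Hd v : exists d, forall p, path R r p -> last r p = v -> size p = d.
  case: (boolP (connect R r v)) => [/connectP[p Pp ->]|nv].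
    by exists (size p) => q Pq E; rewrite (unique_path Pq Pp E).
  by exists 0 => p Pp E; case/connectP: nv; exists p.
have [dep Hdep] := fin_all_exists Hd; exists dep => u v uv.
have /connectP[p Pp Eu] := reach_tail uv.
rewrite -(Hdep u p) // -(Hdep v (rcons p v)) ?size_rcons ?last_rcons //.
by rewrite rcons_path Pp -Eu.
Qed.

Let depth_path dep : (forall u v, R u v -> dep v = (dep u).+1) ->
  forall u p, path R u p -> dep (last u p) = dep u + size p.
Proof.
move=> Hdep u p; elim: p u => [|v p IHp] u /=; first by rewrite addn0.
by move=> /andP[/Hdep Ev /IHp ->]; rewrite Ev addSnnS.
Qed.

Let acyclic u p : path R u p -> last u p = u -> p = [::].
Proof.
have [dep Hdep] := depth_ex; move=> /(depth_path Hdep) + E; rewrite E => /eqP.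
by rewrite -[X in X == _]addn0 eqn_add2l => /eqP/esym/size0nil.
Qed.

(** Parents are unique, so the ancestors of [t] form a chain: the last arcs of the two walks to [t]
    agree and can be removed together. *)
Let chain u v t : connect R u t -> connect R v t -> connect R u v || connect R v u.
Proof.
move=> /connectP[p + ->]; elim/last_ind: p => [|p w IHp] /=.
  by move=> _ ->; rewrite orbT.
rewrite rcons_path last_rcons => /andP[Pp Rp] /connectP[q Pq Ew].
case/lastP: q Pq Ew => [_ /= Ewv|q z].
  apply/orP; left; rewrite -Ewv; apply: connect_trans (connect1 Rp).
  by apply/connectP; exists p.
rewrite rcons_path last_rcons => /andP[Pq Rq] Ewz; rewrite -Ewz in Rq.
apply: IHp => //.
by rewrite (unique_parent Rp Rq); apply/connectP; exists q.
Qed.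

Let D v := [set t in T | connect R v t].

Let D_sub u v : connect R u v -> D v \subset D u.
Proof.
move=> uv; apply/subsetP => t; rewrite !inE => /andP[-> vt].
exact: connect_trans uv vt.
Qed.

(** Two ancestors of [t] are comparable, and comparable vertices of equal depth are equal. *)
Let siblings w u v t : R w u -> R w v -> t \in D u -> t \in D v -> u = v.
Proof.
move=> wu wv; rewrite !inE => /andP[_ ut] /andP[_ vt].
have [dep Hdep] := depth_ex.
have Euv : dep u = dep v by rewrite (Hdep _ _ wu) (Hdep _ _ wv).
have same a b : dep a = dep b -> connect R a b -> a = b.
  move=> Eab /connectP[p Pp Eb]; have := depth_path Hdep Pp.
  rewrite -Eb Eab -[LHS]addn0 => /eqP; rewrite eqn_add2l => /eqP/esym/size0nil p0.
  by rewrite Eb p0.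
by case/orP: (chain ut vt) => /same; [apply | move=> H; apply/esym/H].
Qed.

(* [v] is the lowest vertex with its set [D v]. *)
Let key v := [&& v != r, D v != set0 & [forall w, R v w ==> (D w != D v)]].

(** The two vertices are comparable through a common terminal. If they differed, the child of the
    upper one towards the lower one would have the same set, against the upper one being a key. *)
Let key_inj u v : key u -> key v -> D u = D v -> u = v.
Proof.
move=> ku kv Euv; have /and3P[_ /set0Pn[t] + _] := ku => tu.
have tv : t \in D v by rewrite -Euv.
have half a b : key a -> D a = D b -> connect R a b -> a = b.
  move=> /and3P[_ _ /forallP ka] Eab /connectP[[|w p] /= Pp Eb //].
  case/andP: Pp => aw wp; have := ka w; rewrite aw /= eqEsubset.
  rewrite D_sub ?connect1 //= Eab D_sub //.
  by apply/connectP; exists p.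
move: tu tv; rewrite !inE => /andP[_ ut] /andP[_ vt].
by case/orP: (chain ut vt) => /half; [apply | move=> H; apply/esym/H].
Qed.

(** Climbs from [v] to the nearest key or root strictly above it; [q] is the interior of the path.
    All vertices below the upper end have the set of [v], which gives constant load on the path and
    later the disjointness of paths. *)
Let climb v : v != r -> connect R r v -> D v != set0 ->
  exists u q, [/\ (u == r) || key u, path R u (rcons q v),
    {in q, forall w, ~~ ((w == r) || key w)} & {in rcons q v, forall w, D w = D v}].
Proof.
move=> v_r /connectP[p Pp Ev]; move: v_r Pp; rewrite {v}Ev.
elim/last_ind: p => [|p y IHp] /=; first by rewrite eqxx.
rewrite rcons_path last_rcons => y_r /andP[Pp Ry] Dy; set w := last r p in Ry *.
have [kw|nkw] := boolP ((w == r) || key w).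
  by exists w, [::]; split=> //=; [rewrite Ry | move=> z; rewrite inE => /eqP->].
have Dw : D w != set0.
  have /set0Pn[t ty] := Dy; apply/set0Pn; exists t.
  by apply: (subsetP (D_sub (connect1 Ry))).
have [w_r] : w != r /\ ~~ key w by apply/andP; rewrite -negb_or.
rewrite /key w_r Dw /= => /forallPn[z]; rewrite negb_imply negbK => /andP[wz /eqP Ez].
(* [w] is not a key, so some child [z] has the same set as [w]; sharing a terminal with its sibling
   [y], it is [y], and the set does not change from [y] to [w]. *)
have Eyz : y = z.
  have /set0Pn[t ty] := Dy; apply: (siblings Ry wz ty); rewrite Ez.
  exact: (subsetP (D_sub (connect1 Ry))).
have EDw : D w = D y by rewrite Eyz Ez.
have [//||//|u [q [ku Pq Nq Dq]]] := IHp => //.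
exists u, (rcons q w); split=> //.
- by rewrite rcons_path Pq last_rcons.
- by move=> a; rewrite mem_rcons inE => /predU1P[->|/Nq].
by move=> a; rewrite mem_rcons inE -EDw => /predU1P[->|/Dq].
Qed.

(** A child of [t] with the same set would have [t] below it, closing a cycle. *)
Let terminal_key t : t \in T -> key t.
Proof.
move=> tT; have tD : t \in D t by rewrite inE tT connect0.
apply/and3P; split; first by apply: contraNneq rT => <-.
  by apply/set0Pn; exists t.
apply/forallP => w; apply/implyP => tw; apply: contraTneq tD => <-.
rewrite inE tT /=; apply/negP => /connectP[p Pp Et].
by have /(_ (w :: p)) := @acyclic t; rewrite /= tw Pp -Et => /(_ isT erefl).
Qed.

Let key_reachable v : key v -> connect R r v.
Proof.
move=> /and3P[v_r /set0Pn[t]]; rewrite inE => /andP[/reach_terminal rt vt] _.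
have /orP[//|/connectP[p]] := chain rt vt.
case/lastP: p => [/= _ ->|p w]; first exact: connect0.
by rewrite rcons_path last_rcons => /andP[_ + E]; rewrite -E (negPf (no_parent _)).
Qed.

Let terminal_ex t : t \in T -> exists j : 'I_K, t = terminal I j.
Proof.
rewrite -mem_enum => tT; have lt_t : index t (enum T) < K.
  by rewrite -T_card cardE index_mem.
by exists (Ordinal lt_t); rewrite /terminal nth_index.
Qed.

Let terminal_in (j : 'I_K) : terminal I j \in T.
Proof. by rewrite -mem_enum mem_nth // -cardE T_card. Qed.

Let terminal_inj : injective (@terminal I K).
Proof.
move=> i j /eqP; rewrite nth_uniq ?enum_uniq -?cardE ?T_card //.
by move=> /eqP/val_inj.
Qed.

Theorem skeleton : exists m (s : tree_shape K m) (x : {ffun 'I_m -> V}),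
  [/\ m <= 2 ^ K, shape_ok s, placed s x &
      exists2 mu, vdisj_feasible (expand s x) mu &
        (paths_length (expand s x) mu <= tree_length I S)%R].
Proof.
pose Ks := [set v | key v]; pose m := #|Ks|.
pose x : {ffun 'I_m -> V} := [ffun i => enum_val i].
have x_key i : key (x i) by rewrite ffunE; have := enum_valP i; rewrite inE.
have x_inj : injective x by move=> i j; rewrite !ffunE => /enum_val_inj.
have x_onto v : key v -> exists i, x i = v.
  move=> kv; have vK : v \in Ks by rewrite inE.
  by exists (enum_rank_in vK v); rewrite ffunE enum_rankK_in.
clearbody x; have x_r i : x i != r by have /and3P[] := x_key i.
have climb_x i : exists uq : V * seq V,
    [/\ (uq.1 == r) || key uq.1, path R uq.1 (rcons uq.2 (x i)),
    {in uq.2, forall w, ~~ ((w == r) || key w)} &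
    {in rcons uq.2 (x i), forall w, D w = D (x i)}].
  have reach_x := key_reachable (x_key i); have /and3P[_ Dx _] := x_key i.
  by have [u [q H]] := climb (x_r i) reach_x Dx; exists (u, q).
have [uq Huq] := fin_all_exists climb_x.
pose u i := (uq i).1; pose q i := (uq i).2.
have u_key i : (u i == r) || key (u i) by case: (Huq i).
have u_path i : path R (u i) (rcons (q i) (x i)) by case: (Huq i).
have q_key i w : w \in q i -> ~~ ((w == r) || key w).
  by case: (Huq i) => _ _ H _; apply: H.
have q_D i w : w \in rcons (q i) (x i) -> D w = D (x i).
  by case: (Huq i) => _ _ _; apply.
have pos_ex (j : 'I_K) : exists i, x i = terminal I j.
  by apply: x_onto; apply: terminal_key.
have [pos Hpos] := fin_all_exists pos_ex.
pose A i := [set j : 'I_K | terminal I j \in D (x i)].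
(* The parent is the index of the upper end [u i]; [pick] yields [None] exactly when [u i] is the
   root. *)
pose s : tree_shape K m := ([ffun i => A i], [ffun i => [pick j | x j == u i]], finfun pos).
have tail_u i : tail_key s x i = u i.
  rewrite /tail_key ffunE; case: pickP => [j /eqP //|no_j].
  case/orP: (u_key i) => [/eqP //|/x_onto[j xj]].
  by have := no_j j; rewrite xj eqxx.
have keyE w : is_key x w = (w == r) || key w.
  rewrite /is_key; congr orb; apply/existsP/idP => [[i /eqP<-] //|/x_onto[i <-]].
  by exists i.
have A_D i j : A i = A j -> D (x i) = D (x j).
  move=> EA; apply/setP => t; case tT: (t \in T); last by rewrite !inE tT.
  by have [k ->] := terminal_ex tT; have /setP/(_ k) := EA; rewrite !inE.
have D_inj i j : D (x i) = D (x j) -> i = j.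
  by move=> /(key_inj (x_key i) (x_key j))/x_inj.
have A_card i : #|A i| = #|D (x i)|.
  rewrite -(card_imset _ terminal_inj); apply: eq_card => t.
  apply/imsetP/idP => [[j + ->]|tD]; first by rewrite inE.
  have [j Ej] : exists j : 'I_K, t = terminal I j.
    by apply: terminal_ex; move: tD; rewrite inE => /andP[].
  by exists j; rewrite // inE -Ej.
exists m, s, x; split.
(* Distinct keys have distinct sets, so the keys inject into the subsets of the [K] terminals. *)
- rewrite -[K in 2 ^ K]card_ord -cardsT -card_powerset -[m]card_ord.
  have inj_A : injective A by move=> i j /A_D/D_inj.
  rewrite -(card_imset _ inj_A); apply: subset_leq_card; apply/subsetP => B _.
  by rewrite powersetE subsetT.
- apply/andP; split; last first.
    by apply/forallP => j; rewrite !ffunE inE Hpos inE terminal_in connect0.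
  apply/forallP => i; rewrite !ffunE; case: pickP => // j /eqP xj.
  (* The first vertex [v] below the upper end carries the set of [x i]; the upper end is a key, so
     its own set differs from that of its child [v] and the inclusion is strict. *)
  have [v [uv vD]] : exists v, R (u i) v /\ D v = D (x i).
    have := u_path i; have := @q_D i; case: (q i) => [|v l] /= Hv /andP[uv _].
      by exists (x i).
    by exists v; split=> //; apply: Hv; rewrite mem_head.
  rewrite ffunE -xj in uv *.
  have /and3P[_ _ /forallP/(_ v)] := x_key j; rewrite uv /= vD => neD.
  have subD : D (x i) \subset D (x j) by rewrite -vD; apply/D_sub/connect1.
  rewrite properEcard; apply/andP; split.
    by apply/subsetP => k; rewrite ![k \in _]inE => /(subsetP subD).
  by rewrite !A_card; apply: proper_card; rewrite properEneq neD.
- by split=> // j; rewrite ffunE Hpos.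
pose mu : {ffun 'I_m -> seq 'I_(st_n I + (m + m))} :=
  [ffun i => source_copy I i :: rcons (map (@vertex_copy I m) (q i)) (sink_copy I i)].
have collapse_mu i : map (collapse s x) (mu i) = u i :: rcons (q i) (x i).
  rewrite ffunE /= map_rcons -map_comp /collapse originS originT /= tail_u.
  congr (_ :: rcons _ _); apply: map_id_in => w /q_key; rewrite -keyE.
  by rewrite /= originV => /negPf->.
have orig_mu i : all (fun b => origin s x b == Some (collapse s x b)) (mu i).
  rewrite ffunE /= all_rcons /collapse originS originT !eqxx /= all_map.
  by apply/allP => w /q_key; rewrite -keyE /= originV => /negPf->.
have u_arcs i : all (fun a => R a.1 a.2) (path_arcs (u i :: rcons (q i) (x i))).
  by rewrite -path_all_arcs.
have adj_S a b : R a b -> adj G a b by have [H _ _ _] := S_ok; apply: H.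
have mu_path i : path (adj (expand_graph s x)) (source_copy I i) (behead (mu i)).
  apply: path_expand; first by have := orig_mu i; rewrite ffunE.
  have := collapse_mu i; rewrite ffunE => -[-> ->].
  by apply: sub_path (u_path i); apply: adj_S.
have mu_arcs i a : a \in path_arcs (mu i) ->
    adj (expand_graph s x) a.1 a.2 /\
    (collapse s x a.1, collapse s x a.2) \in path_arcs (u i :: rcons (q i) (x i)).
  move=> a_in; split.
    have := mu_path i; rewrite path_all_arcs; move: a_in.
    by rewrite ffunE => ? /allP; apply.
  rewrite -collapse_mu path_arcs_map.
  exact: (map_f (fun a => (collapse s x a.1, collapse s x a.2)) a_in).
(* A repeated vertex on a walk would give a cycle in the tree. *)
have q_uniq i : uniq (rcons (q i) (x i)).
  suff H v p : path R v p -> uniq (v :: p) by have /andP[] := H _ _ (u_path i).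
  elim: p v => //= w p IHp v /andP[vw wp]; have Up := IHp _ wp.
  move: Up => /= ->; rewrite andbT; apply/negP => v_in.
  have : path R v (w :: p) by rewrite /= vw.
  case/splitPr: v_in => p1 p2; rewrite -cat_rcons cat_path => /andP[/acyclic].
  by rewrite last_rcons => /(_ erefl); case: p1.
have head_in_q i a : a \in path_arcs (u i :: rcons (q i) (x i)) ->
    a.2 \in rcons (q i) (x i) by case/mem_path_arcs.
have arc_S i a : a \in path_arcs (u i :: rcons (q i) (x i)) -> a \in S.
  by move=> /(allP (u_arcs i)); case: a.
exists mu; first split=> /=.
- move=> i; have := mu_path i; rewrite /links !ffunE /= eqxx last_rcons eqxx => -> /=.
  have := q_uniq i; rewrite !rcons_uniq mem_rcons inE !negb_or source_neq_sink /=.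
  case/andP=> _ Uq; rewrite (map_inj_uniq (@lshift_inj _ _)) Uq andbT.
  apply/andP; split; apply/mapP => -[v _ /eqP]; rewrite eq_sym.
    by rewrite (negPf (vertex_neq_source _ _)).
  by rewrite (negPf (vertex_neq_sink _ _)).
- move=> i; apply/allP => -[a b] /[dup] /mu_arcs[adj_ab ab_in] _.
  have [_ _ adjG E] := adj_expand adj_ab.
  have abS := arc_S _ _ ab_in; have [_ _ _ /(_ _ _ abS)] := S_ok.
  rewrite /has_label_in /= E /capacity /= /label_edge; move: adjG; rewrite /adj.
  case: (G _ _) => // e _ /= le_e; rewrite ffunE inE ffunE.
  rewrite inordK ?ltnS ?geq_minr // leq_min; apply/andP; split; last first.
    by rewrite -[leqRHS]card_ord max_card.
  by rewrite A_card -(q_D i _ (head_in_q _ _ ab_in)).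
- move=> i j ne_ij; rewrite disjoint_has; apply/hasPn => a ai; apply/negP => aj.
  case/negP: ne_ij; apply/eqP; move: ai aj; rewrite !ffunE !inE !mem_rcons !inE.
  case: (copyP a) => [v|k|k].
  + rewrite !(negPf (vertex_neq_sink _ _)) !(negPf (vertex_neq_source _ _)) /=.
    (* A vertex on two paths has the set of both lower ends, which are therefore the same key. *)
    rewrite !(mem_map (@lshift_inj _ _)) => vi vj; apply: D_inj.
    by rewrite -(q_D i v) ?(q_D j v) // mem_rcons inE ?vi ?vj orbT.
  + rewrite !(negPf (source_neq_sink _ _ _)) /= => Ei Ej.
    have src l : (source_copy I k == source_copy I l) || (source_copy I k \in
        map (@vertex_copy I m) (q l)) -> k = l.
      case/orP=> [/eqP/source_copy_inj //|/mapP[v _ /esym/eqP]].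
      by rewrite (negPf (vertex_neq_source _ _)).
    by rewrite -(src i Ei) -(src j Ej).
  + rewrite ![sink_copy I k == source_copy I _]eq_sym !(negPf (source_neq_sink _ _ _)) /=.
    have src l : (sink_copy I k == sink_copy I l) || (sink_copy I k \in
        map (@vertex_copy I m) (q l)) -> k = l.
      case/orP=> [/eqP/sink_copy_inj //|/mapP[v _ /esym/eqP]].
      by rewrite (negPf (vertex_neq_sink _ _)).
    by move=> /src <- /src <-.
pose L := flatten [seq path_arcs (u i :: rcons (q i) (x i)) | i <- enum 'I_m].
have -> : paths_length (expand s x) mu = (\sum_(a <- L) len G a)%R.
  rewrite /paths_length big_flatten big_map big_enum /=; apply: eq_bigr => i _.
  rewrite -collapse_mu path_arcs_map big_map [LHS]big_seq [RHS]big_seq.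
  by apply: eq_bigr => -[a b] /mu_arcs[adj_ab _]; rewrite len_expand.
have L_uniq : uniq L.
  apply: uniq_flatten_map; first exact: enum_uniq.
    by move=> i; apply: (@map_uniq _ _ snd); rewrite heads_path_arcs.
  by move=> i j a /head_in_q/q_D Ei /head_in_q/q_D Ej; apply: D_inj; rewrite -Ei.
have L_S a : a \in L -> a \in S by move=> /flattenP[_ /mapP[i _ ->]]; apply: arc_S.
(* The arcs of the paths are distinct arcs of [S]; the remaining arcs of [S] have nonnegative
   lengths, hence an inequality. *)
rewrite /tree_length big_uniq //= [leRHS](bigID (mem L)) /=.
rewrite [X in (_ <= X + _)%R](eq_bigl (mem L)) => [|a]; last first.
  by rewrite /= andb_idl // => /L_S.
by rewrite lerDl; apply: sumr_ge0.
Qed.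

End Skeleton.

Lemma enc_nat_inj : injective (@enc nat_encType).
Proof. by move=> m n []. Qed.

Lemma enc_seq_inj (A : encType) : injective (@enc A) ->
  injective (@enc (seq_encType A)).
Proof.
move=> inj; elim=> [|x s IHs] [|y t] //= [/inj-> Est]; congr cons.
exact: IHs.
Qed.

Lemma enc_option_inj (A : encType) : injective (@enc A) ->
  injective (@enc (option_encType A)).
Proof. by move=> inj [x|] [y|] //= [/inj->]. Qed.

Lemma enc_list_map X (A : encType) (f : X -> data) (g : X -> A) s :
  (forall x, f x = enc (g x)) -> enc_list f s = enc [seq g x | x <- s].
Proof. by move=> fg; elim: s => //= x s IHs; rewrite fg IHs. Qed.

(** * The loop that asks the queries *)

Section QueryLoop.
Variables (B C D : encType).

(** The loop context is a dummy here. The first component of each entry bypasses the oracle and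
    stays attached to the answer. *)
Definition query_step : prog :=
  Fork (Seq (Prim Snd) (Seq (Prim Snd) (Fork (Prim Fst) (Seq (Prim Snd) Query))))
       (Seq (Prim Snd) (Prim Fst)).

Definition query_prog : prog :=
  Fork (Prim Fst)
    (Seq (Fork (Prim (Const (Defs.Num 0)))
               (Fork (Prim (Const (Defs.Num 0))) (Prim Snd)))
         (fold_prog query_step)).

(** [bnd] is chosen before [O] and [ans], since the running time of a reduction must be bounded
    uniformly in the oracle; of the answers it uses only the size bound given by [e] and [f]. They
    come out in reverse order because they are accumulated on a list. *)
Lemma eval_queries e f :
  exists bnd : prod_encType B (seq_encType (prod_encType C D)) -> nat,
  pbound bnd /\ forall (A : encType) O (ans : C * D -> A) b (ys : seq (C * D)),
  (forall ys1 y ys2, ys = ys1 ++ y :: ys2 ->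
     O (enc y.2) = Some (enc (ans y)) /\ sz (ans y) <= e * sz y.2 ^ f) ->
  exists2 t,
    eval O query_prog (enc (b, ys)) (enc (b, rev [seq (y.1, ans y) | y <- ys])) t &
    t <= bnd (b, ys).
Proof.
pose one (z : B * seq (C * D)) := sz z + e * sz z ^ f + 2.
pose acc z := sz z * one z + 1.
pose tau z := 20 * (sz z + acc z + one z + 2).
exists (fun z => 50 * sz z * (1 + sz z + tau z + 1) + 9 * sz z + 9).
split; first by rewrite /tau /acc /one; pb.
move=> A O ans b ys Hys; set z := (b, ys).
pose g l (y : C * D) := (y.1, ans y) :: l.
have gE l s : foldl g l s = catrev [seq (y.1, ans y) | y <- s] l.
  by elim: s l => //= y s IHs l; rewrite IHs.
have Ez : sz z = (sz b + sz ys).+1 by [].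
have S_gt0 : 0 < sz z by exact: sz_gt0.
have Hy ys1 y ys2 : ys = ys1 ++ y :: ys2 -> sz y <= sz z /\ sz (y.1, ans y) < one z.
  move=> Eys; have le_y : sz y <= sz z.
    have := sz_catr ys1 (y :: ys2); rewrite -Eys sz_cons /z sz_pair; lia.
  split=> //; have [_ le_a] := Hys _ _ _ Eys; case: y le_y le_a {Eys} => c d.
  rewrite (sz_pair c d) (sz_pair c) /= /one => le_y le_a.
  have : e * sz d ^ f <= e * sz z ^ f.
    by rewrite leq_mul //; case: (f) => // f'; rewrite leq_exp2r //; lia.
  by lia.
have Hacc s ys2 : ys = s ++ ys2 ->
    sz (rev [seq (y.1, ans y) | y <- s]) <= size s * one z + 1.
  elim/last_ind: s ys2 => [|s y IHs] ys2 //; rewrite cat_rcons => Eys.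
  rewrite map_rcons rev_rcons sz_cons size_rcons mulSn.
  by have := IHs _ Eys; have [_] := Hy _ _ _ Eys; lia.
have [||t et le_t] :=
  @eval_fold O query_step (Defs.Num 0) _ _ (@enc _) (@enc _) g ys [::] (tau z).
- move=> ys1 y ys2 Eys; have [Oy _] := Hys _ _ _ Eys; rewrite gE.
  have [le_y lt_one] := Hy _ _ _ Eys; have := Hacc _ _ Eys.
  rewrite /rev; set l := catrev _ _ => le_l.
  have le_acc : sz l <= acc z.
    apply: leq_trans le_l _; rewrite /acc leq_add2r leq_mul //.
    have le_s : size ys1 <= size ys by rewrite Eys size_cat leq_addr.
    apply: leq_trans le_s _; apply: leq_trans (ltnW (size_le_sz ys)) _.
    by rewrite Ez leqW ?leq_addl.
  have eq_step : eval O (Seq (Prim Snd) Query) (Pair (enc y.1) (enc y.2))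
      (enc (ans y)) (dsize (Pair (enc y.1) (enc y.2)) + dsize (enc y.2) +
      (dsize (enc y.2) + dsize (enc (ans y)))).
    apply: (@EvalSeq _ _ _ _ (enc y.2)); last exact: EvalQuery.
    exact: (@EvalPrim _ Snd (Pair (enc y.1) (enc y.2))).
  eexists.
    apply: (@EvalFork _ _ _ _ (Pair (enc y.1) (enc (ans y))) (enc l)).
      apply: (@EvalSeq _ _ _ _ (Pair (enc l) (enc y))).
        exact: (@EvalPrim _ Snd (Pair _ (Pair _ _))).
      apply: (@EvalSeq _ _ _ _ (enc y)).
        exact: (@EvalPrim _ Snd (Pair _ _)).
      apply: EvalFork eq_step.
      exact: (@EvalPrim _ Fst (Pair (enc y.1) (enc y.2))).
    apply: (@EvalSeq _ _ _ _ (Pair (enc l) (enc y))).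
      exact: (@EvalPrim _ Snd (Pair _ (Pair _ _))).
    exact: (@EvalPrim _ Fst (Pair _ _)).
  have Ey : dsize (enc y) = (dsize (enc y.1) + dsize (enc y.2)).+1 by [].
  move: le_y lt_one le_acc Ey; rewrite sz_pair /tau -!/(sz _) /= trunc_log0 -!/(sz _).
  move: (sz z) (sz l) (sz y) (sz y.1) (sz y.2) (sz (ans y)) (acc z) (one z).
  by lia.
- by rewrite (_ : dsize _ = 1) // /tau; lia.
rewrite gE -/(rev _) in et.
eexists; first apply: EvalFork (EvalPrim _ _ _) (EvalSeq _ et).
  apply: EvalFork (EvalPrim _ _ _) _; exact: EvalFork (EvalPrim _ _ _) (EvalPrim _ _ _).
move: le_t; rewrite /= trunc_log0 -/(sz b) -/(sz ys).
have : 50 * (size ys).+1 * (1 + sz ys + tau z + 1) <= 50 * sz z * (1 + sz z + tau z + 1).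
  have le_s : (size ys).+1 <= sz z.
    by apply: leq_trans (size_le_sz ys) _; rewrite Ez leqW ?leq_addl.
  by rewrite !leq_mul // Ez; lia.
move: Ez.
by rewrite /sz /=; lia.
Qed.

End QueryLoop.

(** * Correctness of the program *)

Definition raw_rat (q : rat) : nat * nat := (absz (numq q), absz (denq q)).

Definition raw_edge (e : option (rat * nat)) : option ((nat * nat) * nat) :=
  if e is Some e' then Some (raw_rat e'.1, e'.2) else None.

Definition raw_of_graph n (G : 'M[option (rat * nat)]_n) : raw_graph :=
  [seq [seq raw_edge (G u v) | v <- enum 'I_n] | u <- enum 'I_n].

Definition raw_instance (I : steiner_instance) :
    nat * (raw_graph * (seq nat * nat)) :=
  (st_n I, (raw_of_graph (st_graph I),
     ([seq val t | t <- enum (st_terminals I)], val (st_root I)))).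

Lemma encode_steiner I : enc_steiner I = enc (raw_instance I).
Proof.
rewrite /enc_steiner; congr (Pair _ (Pair _ (Pair _ _))); last first.
  by rewrite /enc_set (enc_list_map (A := nat_encType) (g := val)).
rewrite /enc_graph (enc_list_map (A := seq_encType (option_encType
   (prod_encType (prod_encType nat_encType nat_encType) nat_encType)))
  (g := fun u => [seq raw_edge (st_graph I u v) | v <- enum 'I_(st_n I)])) // => u.
by apply: enc_list_map => v; case: (st_graph I u v).
Qed.

Lemma map_map_enum (F : finType) B C (f : F -> B) (g : B -> C) :
  map g (map f (enum F)) = [seq g (f i) | i <- enum F].
Proof. by rewrite -map_comp. Qed.

(** * Agreement of the computed data with the encodings *)

Section RawShape.
Variables (K m : nat) (s : tree_shape K m).

(** Indices refer to [raw_keys], which begins with the root: 0 stands for the root and [j.+1] for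
    key [j]. *)
Definition raw_parents : seq nat :=
  [seq if shape_parent s i is Some j then j.+1 else 0 | i <- enum 'I_m].

Definition raw_demands : seq (nat * seq nat) :=
  [seq (val i, map val (enum (demand s i))) | i <- enum 'I_m].

Definition raw_positions : seq (nat * nat) :=
  [seq (val j, (shape_pos s j).+1) | j <- enum 'I_K].

End RawShape.

Section RawExpansion.
Variables (I : steiner_instance) (K m : nat) (s : tree_shape K m).
Variable x : {ffun 'I_m -> 'I_(st_n I)}.
Local Notation G := (st_graph I).
Local Notation r := (st_root I).
Local Notation T := (st_terminals I).
Local Notation n := (st_n I).
Local Notation N := (st_n I + (m + m)).

Definition raw_keys : seq nat := val r :: [seq val (x i) | i <- enum 'I_m].

Definition raw_origin (u : option 'I_n) : nat := if u is Some v then val v else n.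

Lemma nth_enum_map B (d : B) (f : 'I_m -> B) (i : 'I_m) :
  nth d [seq f j | j <- enum 'I_m] i = f i.
Proof. by rewrite (nth_map i) ?size_enum_ord // nth_ord_enum. Qed.

Lemma nth_raw_keys i : nth 0 raw_keys (val i).+1 = val (x i).
Proof. exact: nth_enum_map. Qed.

Lemma raw_originsE :
  raw_origins (raw_parents s) n (raw_of_graph G) raw_keys =
  [seq raw_origin (origin s x a) | a <- enum 'I_N].
Proof.
have enumD (a b : nat) : enum 'I_(a + b) =
    [seq lshift b i | i <- enum 'I_a] ++ [seq rshift a i | i <- enum 'I_b].
  apply: (inj_map (@ord_inj (a + b))); rewrite val_enum_ord map_cat !map_map_enum iotaD.
  congr cat; first by rewrite -val_enum_ord.
  by rewrite add0n -[a in iota a b]addn0 iotaDl -val_enum_ord map_map_enum.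
rewrite !enumD !map_cat !map_map_enum /raw_origins; congr cat; last congr cat.
- rewrite /raw_of_graph size_map size_enum_ord -val_enum_ord map_map_enum.
  apply: eq_map => u; rewrite (originV s x u).
  have -> : all (fun k => val u != k) raw_keys = ~~ is_key x u.
    rewrite /is_key negb_or /=; congr andb; rewrite all_map.
    apply/allP/existsPn => [H i|H i _]; last by rewrite /= eq_sym; apply: H.
    by have := H i (mem_enum _ i); rewrite /= eq_sym.
  by case: (is_key x u).
- rewrite /raw_parents map_map_enum; apply: eq_map => i /=; rewrite originS /= /tail_key.
  by case: (shape_parent s i) => [j|] //; rewrite -nth_raw_keys.
by apply: eq_map => i /=; rewrite originT.
Qed.

(** The index [n] of an isolated vertex is out of range in the matrix, where [nth] returns
    [None]. *)
Lemma lookup_raw (u v : option 'I_n) :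
  lookup (raw_of_graph G) (raw_origin u) (raw_origin v) =
  if (u, v) is (Some a, Some b) then raw_edge (G a b) else None.
Proof.
rewrite /lookup /raw_of_graph; case: u => [a|] /=; last first.
  by rewrite [nth [::] _ _]nth_default ?nth_nil // size_map size_enum_ord.
rewrite (nth_map a) ?size_enum_ord // nth_ord_enum; case: v => [b|] /=; last first.
  by rewrite nth_default // size_map size_enum_ord.
by rewrite (nth_map b) ?size_enum_ord // nth_ord_enum.
Qed.

Definition raw_expand :=
  raw_query K m (raw_demands s) n (raw_of_graph G)
    [seq raw_origin (origin s x a) | a <- enum 'I_N].

Lemma encode_expand : enc_vdisj (expand s x) = enc raw_expand.
Proof.
rewrite /enc_vdisj; congr (Pair _ (Pair _ (Pair _ _))).
  have -> : raw_expand.2.2.1 =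
      let os := [seq raw_origin (origin s x a) | a <- enum 'I_N] in
      [seq [seq relabel K (lookup (raw_of_graph G) a b) | b <- os] | a <- os] by [].
  rewrite /enc_graph /= map_map_enum (enc_list_map (A := seq_encType (option_encType
   (prod_encType (prod_encType nat_encType nat_encType) nat_encType)))
  (g := fun a => [seq relabel K (lookup (raw_of_graph G) (raw_origin (origin s x a)) b)
     | b <- [seq raw_origin (origin s x b) | b <- enum 'I_N]])) // => a.
  rewrite map_map_enum; apply: (enc_list_map (A := option_encType
   (prod_encType (prod_encType nat_encType nat_encType) nat_encType))) => b.
  rewrite /= lookup_raw mxE; case: (origin s x a) (origin s x b) => [u|] [v|] //.
  rewrite /label_edge; case: (G u v) => // e /=.
  by rewrite /enc_ord inordK ?ltnS ?geq_minr.
have -> : raw_expand.2.2.2 =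
  [seq ((n + c.1, n + (m + c.1)), c.2) | c <- raw_demands s] by [].
rewrite /raw_demands map_map_enum; apply: (enc_list_map (A := prod_encType
  (prod_encType nat_encType nat_encType) (seq_encType nat_encType))) => i.
by rewrite /= !ffunE /enc_set (enc_list_map (A := nat_encType) (g := val)).
Qed.

Lemma raw_placedP : #|T| = K ->
  reflect (placed s x)
    (raw_placed m (raw_positions s) [seq val t | t <- enum T] raw_keys).
Proof.
move=> T_card.
have term (j : 'I_K) : nth 0 [seq val t | t <- enum T] (val j) = val (terminal I j).
  by rewrite (nth_map r) // -cardE T_card; apply: ltn_ord.
have pairE i j : i < j -> j <= m -> (i, j) \in index_pairs m.
  move=> lt_ij le_jm; rewrite mem_filter; apply/andP; split=> //.
  by apply/allpairsP; exists (i, j); rewrite !mem_iota; split=> //=; lia.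
apply: (iffP andP) => [[/allP Hne /allP Hpos]|[x_inj x_r x_pos]].
  split=> [i j|i|j].
  - wlog le_ij : i j / i <= j.
      by move=> H; case: (leqP i j) => [/H //|/ltnW/H E /esym/E].
    move: le_ij; rewrite leq_eqVlt => /predU1P[/val_inj //|lt_ij] Exy.
    have /negP[] := Hne _ (pairE i.+1 j.+1 lt_ij (ltn_ord j)); apply/eqP.
    apply: (etrans (nth_raw_keys i)); rewrite Exy.
    exact/esym/nth_raw_keys.
  - have /negP H := Hne _ (pairE 0 i.+1 isT (ltn_ord i)); apply/eqP => xi_r.
    by apply: H; apply/eqP/esym/(etrans (nth_raw_keys i)); rewrite xi_r.
  have := Hpos (val j, (shape_pos s j).+1); rewrite map_f ?mem_enum //.
  by move=> /(_ isT); rewrite term nth_raw_keys => /eqP/val_inj.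
split; apply/allP.
  move=> [i j]; rewrite mem_filter => /andP[lt_ij /allpairsP[[i' j'] [+ + [Ei Ej]]]].
  rewrite !mem_iota !add0n /= => lt_i lt_j; move: lt_ij; rewrite {i}Ei {j}Ej /=.
  move=> lt_ij.
  case: j' lt_j lt_ij => // j; rewrite ltnS => lt_j.
  have Ej := nth_raw_keys (Ordinal lt_j); rewrite /= in Ej; rewrite /= Ej.
  case: i' lt_i => [|i] lt_i lt_ij; first by rewrite /= eq_sym; apply: x_r.
  have lt_im : i < m by lia.
  have := nth_raw_keys (Ordinal lt_im); rewrite /= => ->.
  apply/eqP => /val_inj/x_inj[E]; by rewrite E ltnn in lt_ij.
by move=> _ /mapP[j _ ->]; rewrite /= term -x_pos; apply/eqP/esym/nth_raw_keys.
Qed.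

End RawExpansion.

(** * Lengths, minimum and size of answers *)

Definition to_rat (p : nat * nat) : rat := (p.1%:R / p.2%:R)%R.

Lemma raw_ratK q : (0 <= q)%R -> to_rat (raw_rat q) = q.
Proof.
move=> q_ge0; rewrite /to_rat /= !natr_absz !ger0_norm ?numq_ge0 //.
by rewrite divq_num_den.
Qed.

Lemma to_rat_qadd p q : 0 < p.2 -> 0 < q.2 ->
  to_rat (qadd p q) = (to_rat p + to_rat q)%R.
Proof.
move=> p_gt0 q_gt0; rewrite /to_rat /= natrD !natrM addf_div ?pnatr_eq0 -?lt0n //.
Qed.

Lemma to_rat_sum (b : nat * nat) s : 0 < b.2 -> all (fun q => 0 < q.2) s ->
  0 < (foldl qadd b s).2 /\
  to_rat (foldl qadd b s) = (to_rat b + \sum_(q <- s) to_rat q)%R.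
Proof.
elim: s b => [|q s IHs] b b_gt0 /=; first by rewrite big_nil addr0.
move=> /andP[q_gt0 s_gt0]; have [|? ->] := IHs (qadd b q) _ s_gt0.
  by rewrite muln_gt0 b_gt0.
by split=> //; rewrite to_rat_qadd // big_cons addrA.
Qed.

(** The comparison is only required to be right on [l], as [raw_shorter] agrees with the order of
    the fractions only for positive denominators. *)
Lemma keep_best_spec (X : eqType) (lt : rel X) (f : X -> rat) (l : seq X) :
  {in l &, forall s t, lt s t = (f s < f t)%R} ->
  match foldl (keep_best lt) None l with
  | None => l = [::]
  | Some t => t \in l /\ {in l, forall s, (f t <= f s)%R}
  end.
Proof.
elim/last_ind: l => // l y IHl ltE; rewrite foldl_rcons.
have sub z : z \in l -> z \in rcons l y by rewrite mem_rcons inE => ->; rewrite orbT.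
have /IHl : {in l &, forall s t, lt s t = (f s < f t)%R}.
  by move=> s t ls lt'; apply: ltE; apply: sub.
have y_in : y \in rcons l y by rewrite mem_rcons mem_head.
case: foldl => [z [z_in z_min]|->] /=; last first.
  by split; rewrite ?mem_head // => s; rewrite inE => /eqP->.
rewrite (ltE _ _ y_in (sub _ z_in)).
case: (ltP (f y) (f z)) => [lt_yz|le_zy]; split=> //.
- by move=> t; rewrite mem_rcons inE => /predU1P[-> //|/z_min]; apply/le_trans/ltW.
- exact: sub.
- by move=> t; rewrite mem_rcons inE => /predU1P[-> //|/z_min].
Qed.

Lemma sz_seq_le (A : encType) (s : seq A) c :
  (forall i, i < size s -> forall d, sz (nth d s i) <= c) -> sz s <= size s * c.+1 + 1.
Proof.
elim: s => // x s IHs H; rewrite sz_cons /= mulSn.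
have := H 0 isT x; have := IHs (fun i lt_i => H i.+1 lt_i) => /=; lia.
Qed.

Section Answers.
Variables (I : steiner_instance) (K m : nat) (s : tree_shape K m).
Variable x : {ffun 'I_m -> 'I_(st_n I)}.
Local Notation N := (st_n I + (m + m)).
Let raw_os := [seq raw_origin (origin s x a) | a <- enum 'I_N].

Definition raw_paths (mu : {ffun 'I_m -> seq 'I_N}) : seq (seq nat) :=
  [seq map val (mu i) | i <- enum 'I_m].

Lemma enc_pathsE mu : enc_paths (expand s x) mu = enc (raw_paths mu).
Proof.
rewrite /enc_paths (enc_list_map (A := seq_encType nat_encType)
  (g := fun i => map val (mu i))) // => i.
exact: (enc_list_map (A := nat_encType)).
Qed.

(** There are [m] simple paths, each with at most [N] vertices numbered below [N], and both [m] and
    [N] are below the size of the query, whose matrix has [N] rows. Hence the cube. *)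
Lemma sz_raw_paths mu : vdisj_feasible (expand s x) mu ->
  sz (Some (raw_paths mu)) <= 9 * sz (raw_expand s x) ^ 3.
Proof.
move=> [mu_links _ _]; set Z := sz (raw_expand s x).
have lt_NZ : N < Z.
  have <- : size (raw_expand s x).2.2.1 = N.
    rewrite -[RHS](size_enum_ord N).
    by rewrite -[RHS](size_map (fun a => raw_origin (origin s x a))); apply: size_map.
  apply: leq_trans (size_le_sz _) _.
  by rewrite /Z /raw_expand /raw_query !sz_pair /=; lia.
have le_mu i : sz (map val (mu i) : seq nat) <= Z * Z.
  have le_size : size (mu i) <= N.
    have := mu_links i; rewrite /links; case: (mu i) => // y p /and4P[_ _ _ Up].
    by rewrite -(card_uniqP Up) -[leqRHS]card_ord max_card.
  apply: leq_trans (sz_seq_le (c := N) _) _ => [j|].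
    rewrite size_map => lt_j d; apply: leq_trans (sz_le _) _.
    have [y _] : exists y : 'I_N, true by case: (mu i) lt_j => // y; exists y.
    by rewrite (nth_map y) //; apply: ltn_ord.
  rewrite size_map; move: lt_NZ le_size; move: (size (mu i)) (N) (Z) => a b c.
  by clear; nia.
rewrite sz_some; have := @sz_seq_le (seq_encType nat_encType) (raw_paths mu) (Z * Z).
rewrite size_map size_enum_ord => H.
have {}H : sz (raw_paths mu) <= m * (Z * Z).+1 + 1.
  apply: H => j lt_j d.
  by rewrite (nth_map (Ordinal lt_j)) ?size_enum_ord.
have lt_mZ : m < Z by apply: leq_ltn_trans lt_NZ; lia.
move: H lt_mZ; rewrite !expnS expn0 muln1; move: (sz _) (Z) => a c.
by clear -m; nia.
Qed.

Lemma raw_resultE mu : shape_ok s -> placed s x -> #|st_terminals I| = K ->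
  nonneg_lengths (st_graph I) -> vdisj_feasible (expand s x) mu ->
  let t := raw_result (raw_of_graph (st_graph I)) raw_os (raw_paths mu) in
  [/\ t.2 = [seq (val a.1, val a.2) | a <- tree_arcs s x mu],
      0 < t.1.2 & to_rat t.1 = paths_length (expand s x) mu].
Proof.
move=> s_ok x_ok T_card len_ge0 mu_ok.
have arcsE : flatten [seq zip [seq nth 0 raw_os v | v <- p]
                        (behead [seq nth 0 raw_os v | v <- p]) | p <- raw_paths mu]
    = [seq (val a.1, val a.2) | a <- tree_arcs s x mu].
  rewrite /tree_arcs map_flatten /raw_paths !map_map_enum; congr flatten.
  apply: eq_map => i /=; rewrite -[path_arcs _]/(zip _ _) -zip_behead_map.
  suff -> : [seq nth 0 raw_os v | v <- map val (mu i)] =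
      map val (map (collapse s x) (mu i)) by [].
  rewrite -!map_comp; apply/eq_in_map => a a_in /=.
  rewrite (nth_map a) ?size_enum_ord // nth_ord_enum.
  by rewrite (origin_collapse mu_ok a_in).
rewrite /raw_result arcsE /=.
have [adj_t _ _ _] := collapse_feasible s_ok x_ok T_card mu_ok.
have lengthsE : [seq raw_length (raw_of_graph (st_graph I)) a
     | a <- [seq (val a.1, val a.2) | a <- tree_arcs s x mu]]
   = [seq raw_rat (len (st_graph I) a) | a <- tree_arcs s x mu].
  rewrite -map_comp; apply/eq_in_map => -[u v] uv_in /=.
  have : adj (st_graph I) u v by apply: adj_t; rewrite inE.
  rewrite /raw_length (lookup_raw (Some u) (Some v)) /len /adj /=.
  by case: (st_graph I u v).
rewrite lengthsE; have [|? ->] := @to_rat_sum (0, 1)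
  [seq raw_rat (len (st_graph I) a) | a <- tree_arcs s x mu] isT.
  by rewrite all_map; apply/allP => a _ /=; rewrite absz_gt0 denq_neq0.
split=> //; rewrite -(collapse_length x_ok mu_ok) /to_rat /= mul0r add0r big_map /tree_length.
rewrite [RHS](eq_bigl (mem (tree_arcs s x mu))) => [|a]; last by rewrite inE.
rewrite -big_uniq ?(tree_arcs_uniq x_ok mu_ok) //=; apply: eq_bigr => a _.
exact: raw_ratK.
Qed.

End Answers.

(** * Enumeration of the guesses and the reduction *)

Definition raw_shapes (K : nat) :
    seq (nat * (seq nat * (seq (nat * seq nat) * seq (nat * nat)))) :=
  flatten [seq [seq (m, (raw_parents s, (raw_demands s, raw_positions s)))
                  | s <- enum (tree_shape K m) & shape_ok s]
             | m <- iota 0 (2 ^ K).+1].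

Definition all_candidates K (z : nat * (raw_graph * (seq nat * nat))) :=
  flatten [seq raw_candidates K c.1 c.2.1 c.2.2.1 c.2.2.2 z.1 z.2.1 z.2.2.1 z.2.2.2
             | c <- raw_shapes K].

(** Induction on the constant list of shapes: the program concatenates the outputs of one program
    per shape. *)
Lemma pt_all_candidates K : ptime (all_candidates K).
Proof.
rewrite /all_candidates; elim: (raw_shapes K) => [|c cs IHcs] /=; first exact: pt_cst.
by apply: pt_cat => //; apply: pt_candidates; pt.
Qed.

Lemma candidatesP I K y : #|st_terminals I| = K ->
  reflect (exists m (s : tree_shape K m) (x : {ffun 'I_m -> 'I_(st_n I)}),
      [/\ m <= 2 ^ K, shape_ok s, placed s x &
          y = ([seq raw_origin (origin s x a) | a <- enum 'I_(st_n I + (m + m))],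
               raw_expand s x)])
    (y \in all_candidates K (raw_instance I)).
Proof.
move=> T_card; have sizeM : size (raw_of_graph (st_graph I)) = st_n I.
  by rewrite size_map size_enum_ord.
apply: (iffP flatten_mapP) => [[c]|[m [s [x [le_m s_ok x_ok ->]]]]]; last first.
  exists (m, (raw_parents s, (raw_demands s, raw_positions s))).
    apply/flatten_mapP; exists m; first by rewrite mem_iota.
    by apply/mapP; exists s; rewrite // mem_filter s_ok mem_enum.
  apply/mapP; exists [seq val (x i) | i <- enum 'I_m]; last first.
    by rewrite -[_ :: _]/(raw_keys x) raw_originsE.
  rewrite mem_filter; apply/andP; split; first exact/raw_placedP.
  rewrite mem_tuples size_map size_enum_ord eqxx /= sizeM all_map.
  by apply/allP => i _ /=; rewrite mem_iota ltn_ord.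
move=> /flatten_mapP[m]; rewrite mem_iota => lt_m /mapP[s].
rewrite mem_filter => /andP[s_ok _] -> /= /mapP[x'].
rewrite mem_filter mem_tuples sizeM => /and3P[placed_x /eqP size_x /allP x_lt] ->.
(* The default of [insubd] is never taken, as the entries of [x'] are below [st_n I]. *)
pose x : {ffun 'I_m -> 'I_(st_n I)} := [ffun i : 'I_m => insubd (st_root I) (nth 0 x' i)].
have keysE : val (st_root I) :: x' = raw_keys x.
  congr cons; apply: (@eq_from_nth _ 0) => [|i].
    by rewrite size_map size_enum_ord.
  rewrite size_x => lt_i; rewrite (nth_enum_map _ _ (Ordinal lt_i)) ffunE val_insubd /=.
  have /x_lt /= : nth 0 x' i \in x' by rewrite mem_nth ?size_x.
  by rewrite mem_iota => /= ->.
exists m, s, x; split => //; first by rewrite keysE in placed_x; apply/raw_placedP.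
by rewrite keysE raw_originsE.
Qed.

(** Choice along a finite list, provable by induction; it turns the answers to the queries into a
    function, as [eval_queries] expects. *)
Lemma seq_choice (X : eqType) (Y : Type) (P : X -> Y -> Prop) (y0 : Y) (l : seq X) :
  (forall x, x \in l -> exists y, P x y) ->
  exists f : X -> Y, forall x, x \in l -> P x (f x).
Proof.
elim: l => [|x l IHl] Pl; first by exists (fun=> y0).
have [|f Hf] := IHl; first by move=> z zl; apply: Pl; rewrite inE zl orbT.
have [y Py] := Pl x (mem_head _ _).
exists (fun z => if z == x then y else f z) => z; rewrite inE.
by case: eqP => [-> //|_]; apply: Hf.
Qed.

(* The answer [ans y] only depends on the encoding of a candidate [y]; requiring it
   to be correct for every shape and placement with that encoding makes
   injectivity of the encoding of candidates unnecessary. *)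
Lemma select_correct I K directed
    (ans : seq nat * (nat * (nat * (seq (seq (option ((nat * nat) * nat))) *
             seq ((nat * nat) * seq nat)))) -> option (seq (seq nat))) l :
  steiner_valid directed K I ->
  (forall m (s : tree_shape K m) (x : {ffun 'I_m -> 'I_(st_n I)}),
     m <= 2 ^ K -> shape_ok s -> placed s x ->
     vdisj_answers (expand s x)
       (enc (ans ([seq raw_origin (origin s x a) | a <- enum 'I_(st_n I + (m + m))],
                  raw_expand s x)))) ->
  l =i all_candidates K (raw_instance I) ->
  steiner_answers I
    (enc (raw_select (raw_of_graph (st_graph I), [seq (y.1, ans y) | y <- l]))).
Proof.
move=> [_ _ _ [T_card rT] [len_ge0 _]] ans_ok l_all.
set M := raw_of_graph _; set L := [seq _ | y <- l].
(* Soundness of a result: it lists the arcs of a feasible tree, with the right length and a positive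
   denominator. *)
pose good (t : raw_tree) := exists A : seq ('I_(st_n I) * 'I_(st_n I)),
  [/\ uniq A, steiner_feasible I [set a in A], t.2 = [seq (val a.1, val a.2) | a <- A],
      0 < t.1.2 & to_rat t.1 = tree_length I [set a in A]].
have inj : injective (@enc (option_encType (seq_encType (seq_encType nat_encType)))).
  exact/enc_option_inj/enc_seq_inj/enc_seq_inj/enc_nat_inj.
have resultP t : t \in raw_results M L -> good t.
  move=> /flatten_mapP[_ /mapP[y yl ->]] /=; case Ey: (ans y) => [ps|] //.
  rewrite inE => /eqP->; rewrite l_all in yl.
  have [m [s [x [le_m s_ok x_ok def_y]]]] := candidatesP _ T_card yl.
  have := ans_ok _ _ _ le_m s_ok x_ok; rewrite -def_y Ey.
  case=> [[mu [[mu_ok _] Emu]]|[_ /(inj (Some ps) None) //]].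
  rewrite /= enc_pathsE in Emu; have [->] := inj (Some _) (Some _) Emu.
  have [E1 E2 E3] := raw_resultE s_ok x_ok T_card len_ge0 mu_ok.
  exists (tree_arcs s x mu); rewrite def_y; split=> //.
  - exact: (tree_arcs_uniq x_ok mu_ok).
  - exact: collapse_feasible.
  - by rewrite E3 collapse_length.
(* The skeleton of [S] is one of the guesses, and its optimal paths are no longer than those coming
   from [S]. So some result is no longer than [S], and no result means no feasible tree. *)
have result_le S : steiner_feasible I S ->
    exists2 t, t \in raw_results M L & (to_rat t.1 <= tree_length I S)%R.
  move=> S_ok; have [m [s [x [le_m s_ok x_ok [mu0 mu0_ok le_mu0]]]]] :=
    skeleton S_ok T_card rT len_ge0.
  set y := (([seq raw_origin (origin s x a) | a <- enum 'I_(st_n I + (m + m))],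
               raw_expand s x)).
  have yl : y \in l by rewrite l_all; apply/candidatesP => //; exists m, s, x.
  case: (ans_ok _ _ _ le_m s_ok x_ok) => [[mu [[mu_ok mu_min] Emu]]|[/(_ mu0) //]].
  have Ey : ans y = Some (raw_paths mu) by apply: inj; rewrite Emu /= enc_pathsE.
  have [E1 E2 E3] := raw_resultE s_ok x_ok T_card len_ge0 mu_ok.
  exists (raw_result M y.1 (raw_paths mu)); last by rewrite E3 (le_trans _ le_mu0) ?mu_min.
  apply/flatten_mapP; exists (y.1, ans y); first exact: (map_f (fun y => (y.1, ans y))).
  by rewrite Ey /= mem_head.
have shorterE : {in raw_results M L &, forall t u,
    raw_shorter t u = (to_rat t.1 < to_rat u.1)%R}.
  move=> t u /resultP[? [_ _ _ t_gt0 _]] /resultP[? [_ _ _ u_gt0 _]].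
  rewrite /raw_shorter -ltnNge /to_rat ltr_pdivrMr ?ltr0n // mulrAC.
  by rewrite ltr_pdivlMr ?ltr0n // -!natrM ltr_nat.
have := keep_best_spec shorterE; rewrite /raw_select /=.
case: foldl => [t [/resultP[A [A_uniq A_ok Et _ Elen]] t_min]|no_res]; last first.
  right; split=> // S /result_le[t]; by rewrite no_res.
left; exists A; split=> //; last first.
  rewrite Et /=; congr Pair.
  by rewrite (enc_list_map (A := prod_encType nat_encType nat_encType)
    (g := fun a => (val a.1, val a.2))).
split=> // S /result_le[u /t_min le_tu le_uS].
by rewrite -Elen (le_trans le_tu).
Qed.

Theorem theorem4p5 :
  forall directed : bool,
  exists q : nat -> nat,
  forall K : nat, 1 <= K ->
    poly_time_reducible (ML_CAP_STEINER_TREE directed K)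
                        (ML_LAB_VDISJ_PATH directed (q K)).
Proof.
(* There is one source-sink pair per key vertex, and at most [2 ^ K] key vertices. *)
move=> directed; exists (fun K => 2 ^ K) => K _.
have Pprep : ptime (fun z : nat * (raw_graph * (seq nat * nat)) =>
    (z.2.1, all_candidates K z)).
  by apply: pt_pair; [pt | apply: pt_all_candidates].
have Hprep := pt_size Pprep; have [p1 [tau1 [Htau1 Hp1]]] := Pprep.
have [p3 [tau3 [[a3 [d3 Htau3]] Hp3]]] := pt_select.
pose pairE := prod_encType nat_encType nat_encType.
pose graphE := seq_encType (seq_encType (option_encType (prod_encType pairE nat_encType))).
pose queryE := prod_encType nat_encType (prod_encType nat_encType
  (prod_encType graphE (seq_encType (prod_encType pairE (seq_encType nat_encType))))).
(* The constants 9 and 3 are those of [sz_raw_paths]. *)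
have [bnd [Hbnd Hloop]] := @eval_queries graphE (seq_encType nat_encType) queryE 9 3.
pose tau2 z := bnd (z.2.1, all_candidates K z).
have Htau2 : pbound tau2 by exact: (pb_comp Hprep Hbnd).
have [a [d Hbound]] : pbound (fun z => tau1 z + (tau2 z + a3 * tau2 z ^ d3)) by pb.
exists (Seq p1 (Seq (query_prog) p3)), a, d => O O_solves I I_valid.
have [_ _ _ [T_card _] _] := I_valid; set z := raw_instance I.
have answerP y : y \in all_candidates K z -> exists c : option (seq (seq nat)),
    [/\ O (enc y.2) = Some (enc c), sz c <= 9 * sz y.2 ^ 3 &
    forall m (s : tree_shape K m) (x : {ffun 'I_m -> 'I_(st_n I)}),
      m <= 2 ^ K -> placed s x -> y.2 = raw_expand s x ->
      vdisj_answers (expand s x) (enc c)].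
  have valid m (s : tree_shape K m) (x : {ffun 'I_m -> 'I_(st_n I)}) :
      m <= 2 ^ K -> placed s x -> y.2 = raw_expand s x ->
      exists2 d, O (enc y.2) = Some d & vdisj_answers (expand s x) d.
    move=> le_m x_ok ->; rewrite -encode_expand.
    exact: (O_solves (expand s x) (expand_valid s x I_valid le_m)).
  move=> /(candidatesP _ T_card)[m [s [x [le_m s_ok x_ok Ey]]]].
  have [|e Oe ans_e] := valid _ s x le_m x_ok; first by rewrite Ey.
  (* [O] is a function of the encoding, so the answer obtained for one guess is correct for every
     guess with the same encoding. *)
  have det m' (s' : tree_shape K m') (x' : {ffun 'I_m' -> 'I_(st_n I)}) :
      m' <= 2 ^ K -> placed s' x' -> y.2 = raw_expand s' x' ->
      vdisj_answers (expand s' x') e.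
    by move=> le_m' x'_ok /(valid _ _ _ le_m' x'_ok)[e']; rewrite Oe => -[<-].
  case: ans_e => [[mu [[mu_ok mu_min] Ee]]|[no_mu Ee]].
    exists (Some (raw_paths mu)); rewrite Ee /= enc_pathsE in Oe det; split=> //.
    by rewrite Ey; apply: sz_raw_paths.
  exists None; rewrite Ee in Oe det; split; [exact: Oe | | exact: det].
  by apply: (@leq_trans 1) => //; rewrite muln_gt0 expn_gt0 sz_gt0.
have [ans Hans] := seq_choice None answerP.
have [t1 e1 le_t1] := Hp1 O z.
have [ys1 y ys2 Eys|t2 e2 le_t2] := Hloop _ O ans z.2.1 (all_candidates K z).
  by have [|? ? _] := Hans y; rewrite // Eys mem_cat mem_head orbT.
set L := rev _ in e2; have [t3 e3 le_t3] := Hp3 O (z.2.1, L).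
have Ez : @encode (ML_CAP_STEINER_TREE directed K) I = enc z.
  exact: encode_steiner.
exists (enc (raw_select (z.2.1, L))), (t1 + (t2 + t3)); split.
- by rewrite Ez; apply: EvalSeq e1 (EvalSeq e2 e3).
- rewrite Ez; apply: leq_trans (Hbound z).
  apply: (leq_add le_t1); apply: (leq_add le_t2).
  (* The input of the selection is the output of the query loop, so its size is at most the cost of
     that loop. *)
  apply: leq_trans le_t3 _; apply: leq_trans (Htau3 _) _; rewrite leq_mul //.
  case: d3 {Htau3 Hbound} => // d3; rewrite leq_exp2r //.
  exact: leq_trans (eval_size e2).2 le_t2.
rewrite /L -map_rev; apply: select_correct I_valid _ _ => [m s x le_m s_ok x_ok|y].
  have [|_ _] := Hans ([seq raw_origin (origin s x a) | a <- enum 'I_(st_n I + (m + m))],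
               raw_expand s x); last by apply.
  by apply/candidatesP => //; exists m, s, x.
by rewrite mem_rev.
Qed.
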